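(* Let $d\ge2$, $1\le p<d$ and $w\in\mathcal A_p(\mathbb R^d)$. If every $u\in\dot W^{1,p}(\mathbb R^d,w)$ has a unique almost sure vertical limit, then $\mathcal R_p(w)<\infty$ and for every cube $Q\subset\mathbb R^{d-1}$ it holds that $\inf_{z\in\mathbb N}w(Q\times[z,z+1])>0$.
   Context: Muckenhoupt weights: a non-negative $w\in L^1_{\mathrm{loc}}(\mathbb R^d)$ belongs to $\mathcal A_p(\mathbb R^d)$, $1<p<\infty$, if $w>0$ a.e. and there is $C\ge1$ such that for every ball $B$, $\left(\frac1{|B|}\int_B w\,dx\right)\left(\frac1{|B|}\int_B w^{-1/(p-1)}dx\right)^{p-1}\le C$; it belongs to $\mathcal A_1(\mathbb R^d)$ if $w>0$ a.e. and there is $C\ge1$ such that for every ball $B$, $\frac1{|B|}\int_B w\,dx\le C\,w(y)$ for a.e. $y\in B$. We write $w(A)=\int_Aw\,dx$. Sobolev space: $\dot W^{1,p}(\mathbb R^d,w)$ consists of the functions $u\in L^p_{\mathrm{loc}}(\mathbb R^d,w)$ (for $w\in\mathcal A_p$ these lie in $L^1_{\mathrm{loc}}(\mathbb R^d)$) whose distributional gradient satisfies $|\nabla u|\in L^p(\mathbb R^d,w)$. Every such $u$ is always taken to be its Lebesgue representative with respect to Lebesgue measure: $u(x)=\limsup_{r\to0}\frac1{|B(x,r)|}\int_{B(x,r)}u(y)\,dy$ for every $x$. For a set $A$ of positive Lebesgue measure and $s\in\mathbb R$, $w^s(A)=\left(\int_A w\,dx\right)^s$. With $A_i=\{x\in\mathbb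 R^d:2^i\le|x|<2^{i+1}\}$ for $i\in\mathbb N$, $$\mathcal R_p(w)=\sum_{i\in\mathbb N}(2^i)^{\frac p{p-1}}w^{\frac1{1-p}}(A_i)\ \text{ if }p>1,\qquad \mathcal R_1(w)=\sup_{i\in\mathbb N}2^i\,w^{-1}(A_i).$$ Identify $\mathbb R^d=\mathbb R^{d-1}\times\mathbb R$. A function $u:\mathbb R^d\to\mathbb R$ has a unique almost sure vertical limit if there is a finite constant $c\in\mathbb R$ such that $\lim_{t\to\infty}u(\overline x,t)=c$ for Lebesgue-almost every $\overline x\in\mathbb R^{d-1}$. Cubes are closed with edges parallel to the coordinate axes. *)

(* Defs.v *)
From HB Require Import structures.
From mathcomp Require Import all_boot all_order all_algebra.
From mathcomp Require Import all_classical all_reals all_analysis.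

Set Implicit Arguments.
Unset Strict Implicit.
Unset Printing Implicit Defensive.

Import Order.TTheory GRing.Theory Num.Theory.
Import numFieldNormedType.Exports.

Local Open Scope classical_set_scope.
Local Open Scope ring_scope.

Definition measure_mx_display : measure_display -> measure_display.
Proof. exact. Qed.

(* The product sigma-algebra on matrices; on 'rV[R]_d it is the Borel one. *)
Section measurable_mx.
Context {disp} {T : sigmaRingType disp}.
Variables m n : nat.

Definition mx_cylinders : set (set 'M[T]_(m, n)) :=
  [set X | exists i j, exists2 B : set T, measurable B &
    X = [set M : 'M[T]_(m, n) | B (M i j)]].

Let mx_measurable0 : <<s mx_cylinders >> set0.
Proof. exact: sigma_algebra0. Qed.

Let mx_measurableC A : <<s mx_cylinders >> A -> <<s mx_cylinders >> (~` A).
Proof. exact: sigma_algebraC. Qed.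

Let mx_measurable_bigcup (F : (set 'M[T]_(m, n))^nat) :
  (forall i, <<s mx_cylinders >> (F i)) ->
  <<s mx_cylinders >> (\bigcup_i (F i)).
Proof. exact: sigma_algebra_bigcup. Qed.

HB.instance Definition _ := @isMeasurable.Build (measure_mx_display disp)
  'M[T]_(m, n) <<s mx_cylinders >>
  mx_measurable0 mx_measurableC mx_measurable_bigcup.

End measurable_mx.

(* The point (x, t) of R^(d-1) * R = R^d; the last coordinate is vertical. *)
Definition vjoin {T : Type} {d : nat} (x : 'rV[T]_d.-1) (t : T) : 'rV[T]_d :=
  \row_(i < d) oapp (x ord0) t (insub (val i)).
Arguments vjoin {T} d x t.

Section vjoin_theory.
Context {R : realType}.
Implicit Types n : nat.

Lemma measurable_coord n (j : 'I_n) :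
  measurable_fun [set: 'rV[R]_n] (fun x : 'rV[R]_n => x ord0 j).
Proof.
move=> _ B mB; rewrite setTI; apply: sub_sigma_algebra.
by exists ord0, j, B.
Qed.

Lemma measurable_rV {disp} {T : measurableType disp} n (f : T -> 'rV[R]_n) :
  (forall j, measurable_fun setT (fun x => f x ord0 j)) ->
  measurable_fun setT f.
Proof.
move=> mf; apply: (@measurability _ _ _ _ _ _ (@mx_cylinders _ R 1 n)) => //.
move=> _ [_ [i [j [B mB ->]]] <-].
by rewrite (ord1 i); exact: mf.
Qed.

Lemma measurable_vjoin n :
  measurable_fun [set: 'rV[R]_n * R]
    (fun z : 'rV[R]_n * R => vjoin n.+1 z.1 z.2).
Proof.
apply: measurable_rV => j.
under eq_fun do rewrite mxE.
case: insubP => [k _ _|_] /=; last exact: measurable_snd.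
exact: measurableT_comp (measurable_coord k) measurable_fst.
Qed.

Lemma vjoinK n (x : 'rV[R]_n.+1) :
  vjoin n.+1 (\row_(j < n) x ord0 (widen_ord (leqnSn n) j)) (x ord0 ord_max) = x.
Proof.
apply/rowP => i; rewrite mxE; case: insubP => [k _ /= ki|/= i_ge].
  by rewrite mxE; congr (x _ _); apply/val_inj.
congr (x _ _); apply/val_inj => /=.
by apply/eqP; rewrite eqn_leq leqNgt i_ge /= -ltnS ltn_ord.
Qed.

Lemma vjoin_init n (x : 'rV[R]_n) (t : R) :
  \row_(j < n) (vjoin n.+1 x t) ord0 (widen_ord (leqnSn n) j) = x.
Proof.
apply/rowP => j; rewrite !mxE; case: insubP => [k _ /= kj|/=].
  by congr (x _ _); apply/val_inj.
by rewrite ltn_ord.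
Qed.

Lemma vjoin_last n (x : 'rV[R]_n) (t : R) :
  (vjoin n.+1 x t) ord0 ord_max = t.
Proof. by rewrite mxE; case: insubP => //= k; rewrite ltnn. Qed.

End vjoin_theory.

Section lebesgue_rV.
Context {R : realType}.
Local Open Scope ereal_scope.

Section step.
Variable n : nat.
Variable mu : {sigma_finite_measure set 'rV[R]_n -> \bar R}.

Let join (z : 'rV[R]_n * R) : 'rV[R]_n.+1 := vjoin n.+1 z.1 z.2.

Let measurable_join : measurable_fun [set: 'rV[R]_n * R] join.
Proof. exact: measurable_vjoin. Qed.

Definition lebesgue_rV_step : set 'rV[R]_n.+1 -> \bar R :=
  pushforward (mu \x lebesgue_measure) join.

Let step0 : lebesgue_rV_step set0 = 0.
Proof. by rewrite /lebesgue_rV_step /pushforward preimage_set0 measure0. Qed.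

Let step_ge0 A : 0 <= lebesgue_rV_step A.
Proof. exact: measure_ge0. Qed.

Let step_sigma_additive : semi_sigma_additive lebesgue_rV_step.
Proof.
exact: (@measure_semi_sigma_additive _ _ _
  (pushforward (mu \x lebesgue_measure) join)).
Qed.

HB.instance Definition _ := isMeasure.Build _ _ _ lebesgue_rV_step
  step0 step_ge0 step_sigma_additive.

Let step_sigma_finite : sigma_finite setT lebesgue_rV_step.
Proof.
pose split (x : 'rV[R]_n.+1) : 'rV[R]_n * R :=
  (\row_(j < n) x ord0 (widen_ord (leqnSn n) j), x ord0 ord_max).
have joinK : cancel join split.
  by move=> [x t]; rewrite /split /join /= vjoin_init vjoin_last.
have /sigma_finiteP[F [FT ndF Foo]] := sigma_finiteT mu.
have /sigma_finiteP[G [GT ndG Goo]] := sigma_finiteT (@lebesgue_measure R).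
exists (fun i => split @^-1` (F i `*` G i)).
  rewrite -preimage_bigcup; apply/esym; rewrite -subTset => x _ /=.
  have : setT (split x).1 by []; rewrite FT => -[i _ Fi].
  have : setT (split x).2 by []; rewrite GT => -[j _ Gj].
  exists (maxn i j) => //; split.
    by move: Fi; exact/subsetPset/ndF/leq_maxl.
  by move: Gj; exact/subsetPset/ndG/leq_maxr.
move=> i; have [mFi Fioo] := Foo i; have [mGi Gioo] := Goo i; split.
  rewrite -[X in measurable X]setTI.
  suff : measurable_fun setT split by apply => //; exact: measurableX.
  apply/measurable_fun_pairP; split; last exact: measurable_coord.
  apply: measurable_rV => j /=; under eq_fun do rewrite mxE.
  exact: measurable_coord.
rewrite /lebesgue_rV_step /pushforward -comp_preimage.
have -> : split \o join = id by apply/funext.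
by rewrite preimage_id product_measure1E// lte_mul_pinfty// ge0_fin_numE.
Qed.

HB.instance Definition _ := Measure_isSigmaFinite.Build _ _ _
  lebesgue_rV_step step_sigma_finite.

End step.

Fixpoint lebesgue_rV (d : nat) :
    {sigma_finite_measure set 'rV[R]_d -> \bar R} :=
  match d with
  | 0 => \d_ (0%R : 'rV[R]_0)
  | n.+1 => lebesgue_rV_step (lebesgue_rV n)
  end.

End lebesgue_rV.

Section euclidean.
Context {R : realType} {d : nat}.
Implicit Types (x : 'rV[R]_d) (r : R).

Definition enorm x : R := Num.sqrt (\sum_(i < d) x ord0 i ^+ 2).

(* The topology of 'rV[R]_d comes from the max norm, hence the redefinition. *)
Definition eball x r : set 'rV[R]_d := [set y | enorm (y - x) < r].

(* [a_1, a_1 + l] * ... * [a_d, a_d + l] *)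
Definition cube (a : 'rV[R]_d) (l : R) : set 'rV[R]_d :=
  [set x | forall i, a ord0 i <= x ord0 i <= a ord0 i + l].

Definition annulus (i : nat) : set 'rV[R]_d :=
  [set x | 2 ^+ i <= enorm x < 2 ^+ i.+1].

End euclidean.

Section weighted_sobolev.
Context {R : realType} {d : nat}.
Implicit Types (u v w phi : 'rV[R]_d -> R) (p : R).

Local Notation leb := (@lebesgue_rV R d).

(* Measurability with respect to the completion of the Borel sigma-algebra.
   The integral of such a function is that of any almost everywhere equal Borel
   function, since \int is a supremum over measurable simple minorants. *)
Definition lebesgue_measurable u : Prop :=
  exists2 v, measurable_fun setT v & {ae leb, forall x, u x = v x}.

Definition locally_L1 u : Prop :=
  lebesgue_measurable u /\
  forall K, compact K -> (\int[leb]_(x in K) `|u x|%:E < +oo)%E.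

Definition average (B : set 'rV[R]_d) (f : 'rV[R]_d -> \bar R) : \bar R :=
  ((fine (leb B))^-1%:E * \int[leb]_(y in B) f y)%E.

Definition muckenhoupt_gt1 p w : Prop :=
  exists2 C : R, 1 <= C & forall x r, 0 < r ->
    (average (eball x r) (fun y => (w y)%:E) *
     average (eball x r) (fun y => (w y `^ (- (p - 1)^-1))%:E) `^ (p - 1)
     <= C%:E)%E.

Definition muckenhoupt_1 w : Prop :=
  exists2 C : R, 1 <= C & forall x r, 0 < r ->
    {ae leb, forall y, eball x r y ->
      (average (eball x r) (fun z => (w z)%:E) <= (C * w y)%:E)%E}.

(* The class A_p; relevant for 1 <= p only. *)
Definition muckenhoupt p w : Prop :=
  [/\ forall x, 0 <= w x, locally_L1 w, {ae leb, forall x, 0 < w x} &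
      if p == 1 then muckenhoupt_1 w else muckenhoupt_gt1 p w].

Definition weight_measure w (A : set 'rV[R]_d) : \bar R :=
  (\int[leb]_(x in A) (w x)%:E)%E.

Definition partial (i : 'I_d) phi : 'rV[R]_d -> R :=
  fun x => 'D_(delta_mx ord0 i) phi x.

Definition test_function phi : Prop :=
  (forall (s : seq 'I_d) x, differentiable (foldr partial phi s) x) /\
  compact (closure [set x | phi x != 0]).

Definition distributional_gradient u (g : 'rV[R]_d -> 'rV[R]_d) : Prop :=
  forall i, locally_L1 (fun x => g x ord0 i) /\
    forall phi, test_function phi ->
      (\int[leb]_x (u x * partial i phi x)%:E =
       - \int[leb]_x (g x ord0 i * phi x)%:E)%E.

Definition locally_Lp p w u : Prop :=
  lebesgue_measurable u /\
  forall K, compact K ->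
    (\int[leb]_(x in K) (`|u x| `^ p * w x)%:E < +oo)%E.

Definition homogeneous_sobolev p w u : Prop :=
  locally_Lp p w u /\
  exists2 g, distributional_gradient u g &
    (\int[leb]_x (enorm (g x) `^ p * w x)%:E < +oo)%E.

(* Defined at every point, possibly infinite on a null set. *)
Definition lebesgue_representative u : 'rV[R]_d -> \bar R := fun x =>
  limf_esup (fun r : R => average (eball x r) (fun y => (u y)%:E)) 0^'+.

Definition unique_ae_vertical_limit (u : 'rV[R]_d -> \bar R) : Prop :=
  exists c : R, {ae @lebesgue_rV R d.-1, forall x,
    u (vjoin d x t) @[t --> +oo%R] --> c%:E}.

(* Here 0 < weight_measure w (annulus i) < +oo for w in A_p, so the convention
   +oo `^ s = +oo for s < 0 plays no role. *)
Definition muckenhoupt_R p w : \bar R :=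
  (if p == 1%R then
    ereal_sup [set (2 ^+ i)%:E * weight_measure w (annulus i) `^ (-1)
              | i in [set: nat]]
  else
    \sum_(0 <= i <oo) (((2 ^+ i) `^ (p / (p - 1)))%:E *
                       weight_measure w (annulus i) `^ (1 - p)^-1))%E.

End weighted_sobolev.

(* Main.v *)
Require Import Defs.
From mathcomp Require Import all_boot all_order all_algebra.
From mathcomp Require Import all_classical all_reals all_analysis.
From mathcomp Require Import measurable_realfun ring lra.
Set Implicit Arguments.
Unset Strict Implicit.
Unset Printing Implicit Defensive.
Import Order.TTheory GRing.Theory Num.Theory.
Import numFieldNormedType.Exports.
Local Open Scope classical_set_scope.
Local Open Scope ring_scope.

(** Both conclusions are proved by contraposition: when one of them fails there
    is a C1 function of finite weighted energy that has no finite vertical limit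
    above any point of some set of positive measure.

    If R_p(w) is infinite, let u be radial and increase by b_k when |x| crosses
    the annulus A_k.  Its gradient has size b_k / 2^k there, so that its energy is
    comparable to the sum of (b_k / 2^k)^p w(A_k).  The divergence of R_p(w) is,
    by the duality of l^p with its conjugate space, what allows a choice of
    b_k >= 0 with finite energy and infinite sum ([divergent_increments]); then
    u tends to infinity at infinity ([radial_function_without_limit]).

    If the infimum of the weights of the slabs Q * [z, z + 1] is zero then, as
    each of these weights is positive, there are infinitely many slabs whose
    weights have a finite sum ([summable_subsequence]).  Let u be the sum of
    one bump in each of them, all translates of the same bump.  Its gradient is
    bounded, hence its energy is at most a constant times the sum of the weights.
    Above an interior point of Q, u vanishes at integer heights and keeps
    returning to a fixed positive value at half-integer ones
    ([oscillating_function_without_limit]).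

    Both functions are locally finite sums of C1 functions whose gradients have
    disjoint supports; [sobolev_locally_finite_sum] computes the energy of such a
    sum.  It relies on [C1_distributional_gradient], the integration by parts
    that makes the classical gradient of a C1 function a distributional one.  The
    values at single points matter because a continuous function is its own
    Lebesgue representative ([lebesgue_representative_continuous]).  The weight
    enters through [weight_measure_finpos]: positivity almost everywhere and
    local integrability make the weights of annuli and slabs positive and
    finite. *)

(** * Borel sets and Lebesgue measure on row vectors *)

Section rV_borel.
Context {R : realType}.
Implicit Types n : nat.

Lemma measurable_rV_ball n (x : 'rV[R]_n) (e : R) : measurable (ball x e).
Proof.
have [e0|e0] := ltP 0 e; last first.
  rewrite (_ : ball x e = set0)//; apply/seteqP; split=> // y.
  by rewrite mx_norm_ball /ball_/= => /(le_lt_trans (normr_ge0 _)); rewrite ltNge e0.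
rewrite (_ : ball x e = \bigcap_(j in [set: 'I_n])
    [set y : 'rV[R]_n | ball (x ord0 j) e (y ord0 j)]); last first.
  apply/seteqP; split=> [y [_ xy] j _/=|y xy]; first exact: xy.
  by split=> // i j; rewrite (ord1 i); exact: xy.
apply: fin_bigcap_measurable; [exact: finite_finset|move=> j _].
rewrite -[X in measurable X]setTI.
apply: (measurable_coord j) => //.
by apply: open_measurable; exact: ball_open.
Qed.

(** A family of balls with rational centres and radii is a countable base, so
    the sigma-algebra generated by the coordinates contains the open sets. *)
Lemma open_measurable_rV n (U : set 'rV[R]_n) : open U -> measurable U.
Proof.
move=> oU.
pose B (c : 'rV[rat]_n * nat) : set 'rV[R]_n :=
  ball (map_mx (@ratr R) c.1 : 'rV[R]_n) (c.2.+1%:R^-1).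
rewrite (_ : U = \bigcup_(c in [set: 'rV[rat]_n * nat])
   if `[< B c `<=` U >] then B c else set0).
  apply: countable_bigcupT_measurable; first exact: countableP.
  by move=> c; case: ifP => // _; exact: measurable_rV_ball.
apply/seteqP; split=> [x Ux|x [c _]]; last by case: asboolP => // BU /BU.
have /nbhs_ballP[e /= e0 xeU] := open_nbhs_nbhs (conj oU Ux).
have [k ke] : exists k : nat, k.+1%:R^-1 < e / 2.
  exists (Num.truncn (2 / e)).
  by rewrite -(invf_div 2 e) ltf_pV2 ?posrE ?divr_gt0// truncnS_gt.
have /choice[q qx] : forall j : 'I_n, exists q : rat,
    ratr q \in `]x ord0 j - k.+1%:R^-1, x ord0 j + k.+1%:R^-1[.
  move=> j; apply: rat_in_itvoo.
  by rewrite ltrBlDr -addrA ltrDl addr_gt0 ?invr_gt0.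
have qxk j : `|ratr (q j) - x ord0 j| < k.+1%:R^-1.
  have := qx j; rewrite in_itv/= ltr_norml => /andP[q1 q2].
  by rewrite ltrBrDl q1 ltrBlDl q2.
exists (\row_j q j, k) => //.
have xB : B (\row_j q j, k) x.
  split=> [|i j]; first by rewrite invr_gt0.
  by rewrite (ord1 i) !mxE /ball/=; exact: qxk.
case: asboolP => // -[]; move=> y [_ By]; apply: xeU; split=> // i j.
have := By i j; rewrite (ord1 i) !mxE /ball/= => qy.
rewrite -(subrK (ratr (q j)) (x ord0 j)) -addrA (le_lt_trans (ler_normD _ _))//.
rewrite (splitr e) ltrD// (lt_trans _ ke)// distrC.
exact: qxk.
Qed.

Lemma closed_measurable_rV n (A : set 'rV[R]_n) : closed A -> measurable A.
Proof.
by move=> cA; rewrite -(setCK A); apply: measurableC; apply: open_measurable_rV;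
  exact: closed_openC.
Qed.

Lemma compact_measurable_rV n (A : set 'rV[R]_n) : compact A -> measurable A.
Proof.
by move=> /(compact_closed (@norm_hausdorff _ _)); exact: closed_measurable_rV.
Qed.

Lemma continuous_measurable_rV n (f : 'rV[R]_n -> R) :
  continuous f -> measurable_fun setT f.
Proof.
move=> /continuousP cf.
apply: (measurability _ (RGenOpens.measurableE R)) => _ [_ [a [b ->]] <-].
by rewrite setTI; apply: open_measurable_rV; apply: cf; exact: (@itv_open _ R).
Qed.

Lemma box_measurable n (a b : 'rV[R]_n) :
  measurable [set x : 'rV[R]_n | forall j, a ord0 j <= x ord0 j <= b ord0 j].
Proof.
rewrite (_ : mkset _ = \bigcap_(j in [set: 'I_n])
    [set y : 'rV[R]_n | `[a ord0 j, b ord0 j]%classic (y ord0 j)]).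
  apply: fin_bigcap_measurable; [exact: finite_finset|move=> j _].
  rewrite -[X in measurable X]setTI.
  by apply: (measurable_coord j) => //; exact: measurable_itv.
by apply/seteqP; split => x /= H j; [move=> _|]; have := H j;
  rewrite /= in_itv//=; apply.
Qed.

Lemma cube_measurable n (a : 'rV[R]_n) (l : R) : measurable (cube a l).
Proof.
rewrite (_ : cube a l = [set x | forall j, a ord0 j <= x ord0 j <=
    (a + const_mx l) ord0 j]); first exact: box_measurable.
by apply/seteqP; split => x /= + j => /(_ j); rewrite !mxE.
Qed.

Lemma lebesgue_rVS n : lebesgue_rV n.+1 =
  pushforward (lebesgue_rV n \x @lebesgue_measure R)%E
    (fun z : 'rV[R]_n * R => vjoin n.+1 z.1 z.2) :> (set _ -> \bar R).
Proof. by []. Qed.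

Lemma lebesgue_rV_cube n (a : 'rV[R]_n) (l : R) : 0 <= l ->
  lebesgue_rV n (cube a l) = (l ^+ n)%:E.
Proof.
move=> l0; elim: n a => [a|n IHn a].
  by rewrite /= diracE mem_set//= => -[].
rewrite lebesgue_rVS /pushforward.
pose a' : 'rV[R]_n := \row_(j < n) a ord0 (widen_ord (leqnSn n) j).
rewrite (_ : _ @^-1` _ = cube a' l `*` `[a ord0 ord_max, a ord0 ord_max + l]).
  transitivity (lebesgue_rV n (cube a' l) *
      lebesgue_measure `[a ord0 ord_max, (a ord0 ord_max + l)%R]%classic)%E.
    by apply: product_measure1E; [exact: cube_measurable|exact: measurable_itv].
  rewrite IHn.
  rewrite lebesgue_measure_itv lte_fin ltrDl -EFinD addrAC subrr add0r exprSr.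
  have [->|lN0] := eqVneq l 0; first by rewrite ltxx mulr0 mule0.
  by rewrite lt0r lN0 l0 EFinM.
apply/seteqP; split=> -[x t] /=.
  move=> H; split.
    move=> j; have := H (widen_ord (leqnSn n) j).
    have /rowP/(_ j) := vjoin_init x t; rewrite mxE => ->.
    by rewrite mxE.
  by have := H ord_max; rewrite vjoin_last in_itv.
move=> [H1 H2] i; rewrite mxE; case: insubP => [j _ ji|] /=.
  have -> : i = widen_ord (leqnSn n) j by apply/val_inj => /=.
  by have := H1 j; rewrite mxE.
rewrite -leqNgt => ni; have -> : i = ord_max; last by rewrite in_itv in H2.
by apply/val_inj/eqP; rewrite /= eqn_leq ni -ltnS ltn_ord.
Qed.

Lemma open_lebesgue_rV_gt0 n (U : set 'rV[R]_n) x :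
  open U -> U x -> (0 < lebesgue_rV n U)%E.
Proof.
move=> oU Ux; have /nbhs_ballP[e /= e0 xeU] := open_nbhs_nbhs (conj oU Ux).
apply: (@lt_le_trans _ _ (lebesgue_rV n (cube x (e / 2)))).
  by rewrite lebesgue_rV_cube ?divr_ge0 ?(ltW e0)// lte_fin exprn_gt0// divr_gt0.
apply: le_measure; rewrite ?inE; [exact: cube_measurable|exact: open_measurable_rV|].
move=> y xy; apply: xeU; split=> // i j; rewrite (ord1 i) /ball/=.
by have := xy j; rewrite distrC ltr_norml => /andP[? ?]; lra.
Qed.

Lemma coord_le_norm n (x : 'rV[R]_n) i : `|x ord0 i| <= `|x|.
Proof.
have -> : `|x| = mx_norm x by [].
rewrite mx_normrE.
exact: (le_bigmax _ (fun i : 'I_1 * 'I_n => `|x i.1 i.2|) (ord0, i)).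
Qed.

Lemma norm_le_cube n (x : 'rV[R]_n) (M : R) : `|x| <= M ->
  cube (const_mx (- M)) (M *+ 2) x.
Proof.
move=> xM i; rewrite mxE mulr2n addKr -ler_norml.
exact: le_trans (coord_le_norm x i) xM.
Qed.

Lemma bounded_lebesgue_rV_lty n (A : set 'rV[R]_n) (M : R) :
  measurable A -> (forall x, A x -> `|x| <= M) -> (lebesgue_rV n A < +oo)%E.
Proof.
move=> mA AM.
have AM' x : A x -> `|x| <= `|M| by move=> /AM /le_trans; apply; exact: ler_norm.
apply: (@le_lt_trans _ _ (lebesgue_rV n (cube (const_mx (- `|M|)) (`|M| *+ 2)))).
  apply: le_measure; rewrite ?inE//; first exact: cube_measurable.
  by move=> x /AM'; exact: norm_le_cube.
by rewrite lebesgue_rV_cube ?mulrn_wge0// ltry.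
Qed.

Lemma compact_norm_le n (K : set 'rV[R]_n) : compact K ->
  exists M : R, forall x, K x -> `|x| <= M.
Proof.
move=> /compact_bounded [M [_ KM]]; exists (M + 1) => x Kx.
by apply: (KM (M + 1)) => //; rewrite ltrDl.
Qed.

Lemma compact_lebesgue_rV_lty n (K : set 'rV[R]_n) : compact K ->
  (lebesgue_rV n K < +oo)%E.
Proof.
move=> cK; have [M KM] := compact_norm_le cK.
by apply: bounded_lebesgue_rV_lty KM; exact: compact_measurable_rV.
Qed.

Lemma compact_ball_rV n (M : R) : compact [set x : 'rV[R]_n | `|x| <= M].
Proof.
apply: bounded_closed_compact.
  exists M; split; first exact: num_real.
  by move=> N MN x /= /le_trans; apply; exact: ltW.
apply: (@closed_comp _ _ (fun x : 'rV[R]_n => `|x|) [set y | y <= M]).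
  by move=> x _; exact: norm_continuous.
exact: (@closed_le R).
Qed.

Lemma continuous_compact_bounded n (K : set 'rV[R]_n) (f : 'rV[R]_n -> R) :
  continuous f -> compact K -> exists2 M, 0 <= M & forall x, K x -> `|f x| <= M.
Proof.
move=> cf cK; have [[x0 Kx0]|K0] := pselect (K !=set0); last first.
  by exists 0 => // x Kx; exfalso; apply: K0; exists x.
have cK' : {within K, continuous (fun x => `|f x|)}.
  apply: continuous_subspaceT => x.
  by apply: continuous_comp; [exact: cf|exact: norm_continuous].
have [c _ fc] := EVT_max_rV (ex_intro _ x0 Kx0) cK cK'.
by exists `|f c| => // x Kx; apply: fc; rewrite inE.
Qed.

End rV_borel.

(** * Integrals of almost everywhere comparable functions and of derivatives *)

Section integral_without_measurability.
Context d (T : measurableType d) (R : realType).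
Variable mu : {measure set T -> \bar R}.
Import HBNNSimple.
Local Open Scope ereal_scope.

(** The integral of a nonnegative function is a supremum over measurable simple
    minorants, and a minorant keeps its integral when it is set to zero on a
    null set; hence the comparison holds for arbitrary
    functions.  This is what lets a weight
    be exchanged with the Borel function that it equals almost everywhere. *)
Lemma ge0_le_integral_ae (D : set T) (f g : T -> \bar R) :
  (forall x, 0 <= f x) -> (forall x, 0 <= g x) ->
  {ae mu, forall x, D x -> f x <= g x} ->
  \int[mu]_(x in D) f x <= \int[mu]_(x in D) g x.
Proof.
move=> f0 g0 [N [mN muN0 Nfg]].
have fD0 x : 0 <= (f \_ D) x by exact: erestrict_ge0.
have gD0 x : 0 <= (g \_ D) x by exact: erestrict_ge0.
rewrite integral_mkcond [leRHS]integral_mkcond ge0_integralTE//.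
apply: ge_ereal_sup => _ [h /= hf <-].
rewrite -integralT_nnsfun (@ge0_negligible_integral _ _ _ mu _ N)//; last 2 first.
- exact/measurable_EFinP.
- by move=> x _; rewrite lee_fin.
rewrite setTD integral_nnsfun ?(mrestrict h (measurableC mN)); last exact: measurableC.
rewrite ge0_integralTE//.
apply: ereal_sup_ubound; exists (proj_nnsfun h (measurableC mN)) => //.
move=> x /=; rewrite mindicE.
have [xN|xN] := boolP (x \in ~` N); last by rewrite mulr0 gD0.
rewrite mulr1 (le_trans (hf x))// /patch; case: ifPn => // xD.
apply: contrapT => fg; have : N x; last by move: xN; rewrite inE.
by apply: Nfg => /= H; apply/fg/H; rewrite inE in xD.
Qed.

Lemma ge0_eq_integral_ae (D : set T) (f g : T -> \bar R) :
  (forall x, 0 <= f x) -> (forall x, 0 <= g x) ->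
  {ae mu, forall x, D x -> f x = g x} ->
  \int[mu]_(x in D) f x = \int[mu]_(x in D) g x.
Proof.
move=> f0 g0 fg; apply/eqP; rewrite eq_le; apply/andP; split;
apply: ge0_le_integral_ae => //; move: fg; apply: filterS => x fg Dx.
  by rewrite fg.
by rewrite fg.
Qed.

End integral_without_measurability.

Section line_derivatives.
Context {R : realType}.
Implicit Types n : nat.

Lemma is_derive1_continuous (f g : R -> R) :
  (forall t : R, is_derive t 1 f (g t)) -> continuous f.
Proof.
move=> fg t; apply: differentiable_continuous; apply/derivable1_diffP.
exact: ex_derive.
Qed.

(** The fundamental theorem of calculus on an interval that contains the support
    in its interior. *)
Lemma integral_derive_eq0 (f g : R -> R) (M : R) :
  (forall s : R, is_derive s 1 f (g s)) -> continuous g ->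
  (forall s, M < `|s| -> f s = 0) -> (forall s, M < `|s| -> g s = 0) ->
  (\int[@lebesgue_measure R]_s (g s)%:E = 0)%E.
Proof.
move=> fg cg f0 g0.
pose A := `|M| + 1.
have MA : M < A by rewrite (le_lt_trans (ler_norm M))// ltrDl.
have A0 : 0 < A by rewrite ltr_pwDr.
have cf : continuous f := is_derive1_continuous fg.
transitivity (\int[@lebesgue_measure R]_(s in `[(- A)%R, A]) (g s)%:E)%E.
  rewrite [RHS]integral_mkcond; apply: eq_integral => s _.
  rewrite /patch; case: ifPn => //; rewrite notin_setE/= in_itv/= -ler_norml => /negP.
  by rewrite -ltNge => As; rewrite g0// (lt_trans MA).
rewrite (@continuous_FTC2 _ g f); first last.
- by move=> s _; rewrite derive1E; exact: derive_val.
- split; [by move=> s _; exact: ex_derive|exact: cvg_at_right_filter (cf _)|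
    exact: cvg_at_left_filter (cf _)].
- exact: continuous_subspaceT.
- by rewrite gtrN.
by rewrite !f0 ?normrN ?gtr0_norm// sube0.
Qed.

Lemma integrable_bounded_support n (f : 'rV[R]_n -> R) (M C : R) :
  measurable_fun setT f -> (forall x, `|f x| <= C) ->
  (forall (x : 'rV[R]_n) j, M < `|x ord0 j| -> f x = 0) ->
  (lebesgue_rV n).-integrable setT (EFin \o f).
Proof.
move=> mf fC f0; apply/integrableP; split; first exact/measurable_EFinP.
pose K : set 'rV[R]_n := cube (const_mx (- `|M|)) (`|M| *+ 2).
have mK : measurable K by exact: cube_measurable.
have mfE : measurable_fun setT (fun x => `|(f x)%:E|%E).
  by apply: measurableT_comp => //; exact/measurable_EFinP.
apply: (@le_lt_trans _ _ (\int[lebesgue_rV n]_(x in K) `|(f x)%:E|)%E).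
  rewrite [leRHS]integral_mkcond; apply: ge0_le_integral => //.
  - by apply/(measurable_restrictT _ _).1 => //; exact: measurable_funTS.
  move=> x _; rewrite /patch; case: ifPn => //; rewrite notin_setE => NKx.
  have [j Mj] : exists j, M < `|x ord0 j|.
    apply: contrapT => /forallNP H; apply: NKx => i; rewrite mxE mulr2n addKr -ler_norml.
    by have := H i; move/negP; rewrite -leNgt => /le_trans; apply; exact: ler_norm.
  by rewrite /= (f0 _ j)// normr0.
apply: (@le_lt_trans _ _ (C%:E * lebesgue_rV n K)%E).
  apply: integral_le_bound => //.
  - by apply: measurable_funTS; exact/measurable_EFinP.
  - by rewrite lee_fin (le_trans _ (fC 0)).
  - by apply: aeW => x _; rewrite lee_fin.
by rewrite lebesgue_rV_cube ?mulrn_wge0// -EFinM ltry.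
Qed.

Lemma vjoin_delta_max n (x : 'rV[R]_n) (s t : R) :
  vjoin n.+1 x t + s *: delta_mx ord0 ord_max = vjoin n.+1 x (t + s).
Proof.
apply/rowP => k; rewrite !mxE eqxx/=; case: insubP => [j _ jk|] /=.
  rewrite (_ : k == ord_max = false) ?mulr0 ?addr0//.
  by apply/negbTE; rewrite -val_eqE/= -jk neq_ltn ltn_ord.
rewrite -leqNgt => nk; rewrite (_ : k == ord_max) ?mulr1//.
by rewrite -val_eqE/= eqn_leq nk -ltnS ltn_ord.
Qed.

Lemma vjoin_delta_widen n (x : 'rV[R]_n) (j : 'I_n) (s t : R) :
  vjoin n.+1 x t + s *: delta_mx ord0 (widen_ord (leqnSn n) j) =
  vjoin n.+1 (x + s *: delta_mx ord0 j) t.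
Proof.
apply/rowP => k; rewrite !mxE eqxx/=; case: insubP => [i _ ik|] /=.
  by rewrite !mxE eqxx/= -(val_eqE k) /= -ik.
rewrite -leqNgt => nk; rewrite (_ : k == _ = false) ?mulr0 ?addr0//.
by apply/negbTE; rewrite -val_eqE/= neq_ltn (leq_trans (ltn_ord j) nk) orbT.
Qed.

Lemma vjoin_widen n (x : 'rV[R]_n) (t : R) j :
  vjoin n.+1 x t ord0 (widen_ord (leqnSn n) j) = x ord0 j.
Proof. by have /rowP/(_ j) := vjoin_init x t; rewrite mxE. Qed.

Lemma integral_lebesgue_rVS n (f : 'rV[R]_n.+1 -> \bar R) :
  (\int[lebesgue_rV n.+1]_x f x =
   \int[pushforward (lebesgue_rV n \x @lebesgue_measure R)
     (fun z : 'rV[R]_n * R => vjoin n.+1 z.1 z.2)]_x f x)%E.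
Proof. by apply: eq_measure_integral => [|A mA _]; first exact: measurable_vjoin. Qed.

(** By Fubini the coordinate of differentiation can be integrated first, whatever
    its position in the iterated product; that inner integral is zero. *)
Lemma integral_line_derive_eq0 n (i : 'I_n) (f g : 'rV[R]_n -> R) (M C : R) :
  measurable_fun setT g -> (forall x, `|g x| <= C) ->
  (forall (x : 'rV[R]_n) j, M < `|x ord0 j| -> f x = 0) ->
  (forall (x : 'rV[R]_n) j, M < `|x ord0 j| -> g x = 0) ->
  (forall (x : 'rV[R]_n) (s : R), is_derive s 1 (fun r : R => f (x + r *: delta_mx ord0 i))
    (g (x + s *: delta_mx ord0 i))) ->
  (forall (x : 'rV[R]_n), continuous (fun r : R => g (x + r *: delta_mx ord0 i))) ->
  (\int[lebesgue_rV n]_x (g x)%:E = 0)%E.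
Proof.
elim: n i f g => [[]//|n IHn] i f g mg gC f0 g0 fg cg.
pose join (z : 'rV[R]_n * R) := vjoin n.+1 z.1 z.2.
have mjoin : measurable_fun setT join by exact: measurable_vjoin.
have mgj : measurable_fun setT (EFin \o g \o join).
  by apply: measurableT_comp => //; exact/measurable_EFinP.
have igj : (lebesgue_rV n \x @lebesgue_measure R)%E.-integrable setT
    (EFin \o g \o join).
  apply/integrableP; split => //.
  have /integrableP[_] := integrable_bounded_support mg gC g0.
  rewrite integral_lebesgue_rVS ge0_integral_pushforward ?preimage_setT//.
  by apply: measurableT_comp => //; exact/measurable_EFinP.
rewrite integral_lebesgue_rVS integral_pushforward ?preimage_setT//; last first.
  exact/measurable_EFinP.
have [imax|] := eqVneq i ord_max.
  rewrite -integral12_prod_meas1//.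
  apply: integral0_eq => x _ /=.
  apply: (@integral_derive_eq0 (fun t => f (vjoin n.+1 x t)) _ M).
  - move=> s; have := fg (vjoin n.+1 x 0) s.
    rewrite imax vjoin_delta_max add0r.
    by under [X in is_derive _ _ X _]eq_fun do rewrite vjoin_delta_max add0r.
  - have := cg (vjoin n.+1 x 0); rewrite imax.
    by under eq_fun do rewrite vjoin_delta_max add0r.
  - by move=> s Ms; apply: (f0 _ ord_max); rewrite vjoin_last.
  - by move=> s Ms; apply: (g0 _ ord_max); rewrite vjoin_last.
move=> imax; have [j ij] : exists j, i = widen_ord (leqnSn n) j.
  have ni : (i < n)%N.
    by move: imax; rewrite -val_eqE/= neq_ltn => /orP[//|]; rewrite ltnNge -ltnS ltn_ord.
  by exists (Ordinal ni); exact/val_inj.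
rewrite -integral21_prod_meas1//.
apply: integral0_eq => t _ /=.
apply: (IHn j (fun x => f (vjoin n.+1 x t)) (fun x => g (vjoin n.+1 x t))).
- apply: measurableT_comp => //.
  exact: (measurableT_comp mjoin (pair2_measurable t)).
- by [].
- by move=> x k Mx; apply: (f0 _ (widen_ord (leqnSn n) k)); rewrite vjoin_widen.
- by move=> x k Mx; apply: (g0 _ (widen_ord (leqnSn n) k)); rewrite vjoin_widen.
- move=> x s; have := fg (vjoin n.+1 x t) s.
  rewrite ij vjoin_delta_widen.
  by under [X in is_derive _ _ X _]eq_fun do rewrite vjoin_delta_widen.
- move=> x; have := cg (vjoin n.+1 x t); rewrite ij.
  by under eq_fun do rewrite vjoin_delta_widen.
Qed.

End line_derivatives.

(** * C1 functions and distributional gradients *)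

Section C1_functions.
Context {R : realType} {n : nat}.
Implicit Types (x : 'rV[R]_n) (i : 'I_n).

(** The derivatives are those of the restrictions to coordinate lines, the form
    to which the fundamental theorem of calculus applies. *)
Definition C1_gradient (u : 'rV[R]_n -> R) (g : 'rV[R]_n -> 'rV[R]_n) : Prop :=
  [/\ continuous u, forall i, continuous (fun x => g x ord0 i) &
    forall i x (s : R), is_derive s 1 (fun r : R => u (x + r *: delta_mx ord0 i))
      (g (x + s *: delta_mx ord0 i) ord0 i)].

Lemma continuous_line (f : 'rV[R]_n -> R) x (v : 'rV[R]_n) : continuous f ->
  continuous (fun r : R => f (x + r *: v)).
Proof.
move=> cf r; apply: continuous_comp; last exact: cf.
by apply: continuousD; [exact: cst_continuous|exact: scalel_continuous].
Qed.

Lemma is_derive_line (f : 'rV[R]_n -> R) x (v : 'rV[R]_n) (s df : R) :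
  is_derive (x + s *: v) v f df -> is_derive s 1 (fun r : R => f (x + r *: v)) df.
Proof.
have E : (fun h : R => h^-1 *: (((fun r : R => f (x + r *: v)) \o shift s) (h *: (1 : R))
      - f (x + s *: v))) =
    (fun h : R => h^-1 *: ((f \o shift (x + s *: v)) (h *: v) - f (x + s *: v))).
  by apply/funext => h /=; rewrite [h *: 1]mulr1 scalerDl addrCA.
by case=> dv dE; apply: DeriveDef; rewrite /derivable /derive E.
Qed.

Lemma test_function_C1 (phi : 'rV[R]_n -> R) : test_function phi ->
  C1_gradient phi (fun x => \row_i partial i phi x).
Proof.
move=> [dphi _]; split.
- by move=> x; apply: differentiable_continuous; exact: (dphi [::]).
- move=> i; under eq_fun do rewrite mxE.
  by move=> x; apply: differentiable_continuous; exact: (dphi [:: i]).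
- move=> i x s; apply: is_derive_line; rewrite mxE.
  apply: DeriveDef => //; apply: diff_derivable; exact: (dphi [::]).
Qed.

Lemma test_function_bounded_support (phi : 'rV[R]_n -> R) : test_function phi ->
  exists M : R, forall x, M < `|x| -> phi x = 0 /\ forall i, partial i phi x = 0.
Proof.
move=> [_ /compact_norm_le[M KM]]; exists M => x Mx.
have phi0 y : ~ closure [set x | phi x != 0] y -> phi y = 0.
  by move=> Ny; apply: contrapT => /eqP y0; apply: Ny; exact: subset_closure.
have NKx : ~ closure [set x | phi x != 0] x.
  by move=> /KM; rewrite leNgt Mx.
split; first exact: phi0.
move=> i; rewrite /partial.
rewrite (@near_eq_derive _ _ _ phi (cst 0)) ?derive_cst//.
have : nbhs x (~` closure [set x | phi x != 0]).
  by apply: open_nbhs_nbhs; split => //; apply: closed_openC; exact: closed_closure.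
by apply: filterS => y /phi0.
Qed.

Lemma continuous_support_bounded (f : 'rV[R]_n -> R) (M : R) :
  continuous f -> (forall x, M < `|x| -> f x = 0) ->
  exists C : R, forall x, `|f x| <= C.
Proof.
move=> cf f0.
have cK := @compact_ball_rV R n M.
have [C C0 fC] := continuous_compact_bounded cf cK.
exists C => x; have [xM|Mx] := leP `|x| M; first exact: fC.
by rewrite f0// normr0.
Qed.

Lemma continuous_locally_L1 (f : 'rV[R]_n -> R) : continuous f -> locally_L1 f.
Proof.
move=> cf; have mf := continuous_measurable_rV cf; split.
  by exists f => //; exact: aeW.
move=> K cK; have [M M0 fM] := continuous_compact_bounded cf cK.
apply: (@le_lt_trans _ _ (M%:E * lebesgue_rV n K)%E).
  have := @integral_le_bound _ _ _ (lebesgue_rV n) K (EFin \o f) M%:E.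
  apply => //; first exact: compact_measurable_rV.
    by apply: measurable_funTS; exact/measurable_EFinP.
  by apply: aeW => x Kx; rewrite lee_fin fM.
by apply: lte_mul_pinfty => //; exact: compact_lebesgue_rV_lty.
Qed.

(** Integration by parts: the product of a C1 function and a test function has a
    gradient with zero integral. *)
Lemma C1_distributional_gradient u g :
  C1_gradient u g -> distributional_gradient u g.
Proof.
move=> [cu cg dug] i; split; first exact/continuous_locally_L1/cg.
move=> phi tphi; have [cphi cdphi dphi] := test_function_C1 tphi.
have [M phi0] := test_function_bounded_support tphi.
have cdi : continuous (partial i phi).
  by have := cdphi i; under eq_fun do rewrite mxE.
have phi0j x j : M < `|x ord0 j| -> M < `|x|.
  by move=> /lt_le_trans; apply; exact: coord_le_norm.
have c1 : continuous (fun x => u x * partial i phi x).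
  by move=> x; apply: continuousM; [exact: cu|exact: cdi].
have c2 : continuous (fun x => g x ord0 i * phi x).
  by move=> x; apply: continuousM; [exact: cg|exact: cphi].
have z1 x : M < `|x| -> u x * partial i phi x = 0.
  by move=> /phi0[_ ->]; rewrite mulr0.
have z2 x : M < `|x| -> g x ord0 i * phi x = 0.
  by move=> /phi0[-> _]; rewrite mulr0.
have [C1 b1] := continuous_support_bounded c1 z1.
have [C2 b2] := continuous_support_bounded c2 z2.
have i1 : (lebesgue_rV n).-integrable setT (EFin \o (fun x => u x * partial i phi x)).
  apply: (integrable_bounded_support _ b1) => [|x j /phi0j /z1//].
  exact: continuous_measurable_rV.
have i2 : (lebesgue_rV n).-integrable setT (EFin \o (fun x => g x ord0 i * phi x)).
  apply: (integrable_bounded_support _ b2) => [|x j /phi0j /z2//].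
  exact: continuous_measurable_rV.
have f1 := integrable_fin_num measurableT i1.
have f2 := integrable_fin_num measurableT i2.
suff : (\int[lebesgue_rV n]_x (u x * partial i phi x)%:E +
    \int[lebesgue_rV n]_x (g x ord0 i * phi x)%:E = 0)%E.
  move: f1 f2 => /=.
  move/fineK => <- /fineK <-; rewrite -EFinD -EFinN => -[].
  by move/eqP; rewrite addr_eq0 => /eqP ->.
rewrite -integralD//.
transitivity (\int[lebesgue_rV n]_x
    (u x * partial i phi x + g x ord0 i * phi x)%:E)%E.
  by apply: eq_integral => x _; rewrite EFinD.
apply: (@integral_line_derive_eq0 _ n i (fun x => u x * phi x) _ M (C1 + C2)).
- by apply: measurable_funD; exact: continuous_measurable_rV.
- by move=> x; rewrite (le_trans (ler_normD _ _))// lerD.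
- by move=> x j /phi0j /phi0[-> _]; rewrite mulr0.
- by move=> x j /phi0j Mx; rewrite z1// z2// addr0.
- move=> x s; have := is_deriveM (dug i x s) (dphi i x s).
  by rewrite mxE => H; apply: (@is_derive_eq _ _ _ _ _ _ _ _ H); rewrite /GRing.scale/=; ring.
- move=> x; apply: (@continuous_line
      (fun y => u y * partial i phi y + g y ord0 i * phi y)) => y.
  exact: cvgD (c1 y) (c2 y).
Qed.

End C1_functions.

(** * Euclidean norm, averages and Lebesgue representatives *)

Section enorm_theory.
Context {R : realType} {n : nat}.
Implicit Types (x y : 'rV[R]_n) (r : R).

Lemma continuous_mul (T : topologicalType) (f g : T -> R) :
  continuous f -> continuous g -> continuous (fun z => f z * g z).
Proof. by move=> cf cg z; exact: cvgM (cf z) (cg z). Qed.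

Lemma continuous_big_sum (T : topologicalType) (I : Type) (s : seq I)
    (F : I -> T -> R) :
  (forall k, continuous (F k)) -> continuous (fun z => \sum_(k <- s) F k z).
Proof.
move=> cF; elim: s => [|k s IH] z.
  by under eq_fun do rewrite big_nil; exact: cst_continuous.
under eq_fun do rewrite big_cons.
exact: cvgD (cF k z) (IH z).
Qed.

Lemma continuous_big_prod (T : topologicalType) (I : Type) (s : seq I)
    (F : I -> T -> R) :
  (forall i, continuous (F i)) -> continuous (fun z => \prod_(i <- s) F i z).
Proof.
move=> cF; elim: s => [|i s IH].
  by move=> z; under eq_fun do rewrite big_nil; exact: cst_continuous.
by under eq_fun do rewrite big_cons; exact: continuous_mul.
Qed.

Lemma continuous_sqnorm : continuous (fun x => \sum_(i < n) x ord0 i ^+ 2).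
Proof.
apply: continuous_big_sum => i x.
apply: (@continuous_comp _ _ _ (fun x : 'rV[R]_n => x ord0 i) (fun t : R => t ^+ 2)).
  exact: coord_continuous.
exact: exprn_continuous.
Qed.

Lemma enorm_continuous : continuous (@enorm R n).
Proof.
move=> x; rewrite /enorm.
apply: (@continuous_comp _ _ _ (fun x : 'rV[R]_n => \sum_(i < n) x ord0 i ^+ 2)).
  exact: continuous_sqnorm.
exact: sqrt_continuous.
Qed.

Lemma enorm_ge0 x : 0 <= enorm x. Proof. exact: sqrtr_ge0. Qed.

Lemma sqr_enorm x : enorm x ^+ 2 = \sum_(i < n) x ord0 i ^+ 2.
Proof. by rewrite sqr_sqrtr// sumr_ge0// => i _; exact: sqr_ge0. Qed.

Lemma coord_le_enorm x i : `|x ord0 i| <= enorm x.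
Proof.
rewrite -sqrtr_sqr; apply: ler_wsqrtr.
by rewrite (bigD1 i)//= lerDl sumr_ge0// => j _; exact: sqr_ge0.
Qed.

Lemma enorm_le x r : (forall i, `|x ord0 i| <= r) -> 0 <= r ->
  enorm x <= Num.sqrt n%:R * r.
Proof.
move=> xr r0; rewrite -(ger0_norm r0) -sqrtr_sqr -sqrtrM ?ler0n//.
apply: ler_wsqrtr; rewrite mulr_natl -[X in _ *+ X](card_ord n) -sumr_const.
by apply: ler_sum => i _; rewrite -(real_normK (num_real _)) lerXn2r ?nnegrE.
Qed.

Lemma enorm0 : enorm (0 : 'rV[R]_n) = 0.
Proof.
by rewrite /enorm big1 ?sqrtr0// => i _; rewrite mxE expr0n.
Qed.

Lemma norm_le_enorm x : `|x| <= enorm x.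
Proof.
have -> : `|x| = mx_norm x by [].
rewrite mx_normrE; apply: bigmax_le => [|[i j] _]; first exact: enorm_ge0.
by rewrite /= (ord1 i); exact: coord_le_enorm.
Qed.

Lemma eball_open x r : open (eball x r).
Proof.
have := @open_lt R r; apply: open_comp => y _.
apply: (@continuous_comp _ _ _ (fun y => y - x)); last exact: enorm_continuous.
by apply: continuousB; [exact: id|exact: cst_continuous].
Qed.

Lemma eball_lebesgue_rV x r : 0 < r ->
  (0 < lebesgue_rV n (eball x r))%E /\ lebesgue_rV n (eball x r) \is a fin_num.
Proof.
move=> r0; split.
  apply: (@open_lebesgue_rV_gt0 _ _ _ x); first exact: eball_open.
  by rewrite /eball/= subrr enorm0.
rewrite ge0_fin_numE//; apply: (@bounded_lebesgue_rV_lty _ _ _ (`|x| + r)).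
  apply: open_measurable_rV; exact: eball_open.
move=> y xy; rewrite -(subrK x y) addrC (le_trans (ler_normD _ _))// lerD2l.
exact/ltW/(le_lt_trans (norm_le_enorm _)).
Qed.

Lemma average_bounds (u : 'rV[R]_n -> R) x r (a b : R) : continuous u -> 0 < r ->
  (forall y, eball x r y -> a <= u y <= b) ->
  (a%:E <= average (eball x r) (EFin \o u) <= b%:E)%E.
Proof.
move=> cu r0 uab; have [B0 Bfin] := eball_lebesgue_rV x r0.
have mB : measurable (eball x r) by apply: open_measurable_rV; exact: eball_open.
have Boo : (lebesgue_rV n (eball x r) < +oo)%E by rewrite -ge0_fin_numE.
have iu : (lebesgue_rV n).-integrable (eball x r) (EFin \o u).
  apply: measurable_bounded_integrable => //.
    by apply: measurable_funTS; exact: continuous_measurable_rV.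
  exists (`|a| + `|b|); split; first exact: num_real.
  move=> M MM y /uab /andP[au ub]; rewrite /= (le_trans _ (ltW MM))//.
  rewrite ler_norml; apply/andP; split.
    by rewrite (le_trans _ au)// lerNl (le_trans (ler_norm _))// normrN lerDl.
  by rewrite (le_trans ub)// (le_trans (ler_norm _))// lerDr.
have ic (c : R) : (lebesgue_rV n).-integrable (eball x r) (EFin \o cst c).
  apply: measurable_bounded_integrable => //.
  exists `|c|; split; first exact: num_real.
  by move=> M MM y _ /=; exact: ltW.
have avgc (c : R) : average (eball x r) (EFin \o cst c) = c%:E.
  rewrite /average.
  have -> : (\int[lebesgue_rV n]_(y in eball x r) (EFin \o cst c) y =
      c%:E * (fine (lebesgue_rV n (eball x r)))%:E)%E.
    by rewrite fineK//; exact (integral_cst (lebesgue_rV n) mB c%:E).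
  rewrite -!EFinM mulrCA mulVf ?mulr1// gt_eqF// fine_gt0// B0.
  by rewrite -ge0_fin_numE.
have V0 : (0 <= (fine (lebesgue_rV n (eball x r)))^-1%:E)%E.
  by rewrite lee_fin invr_ge0 fine_ge0.
apply/andP; split.
  rewrite -(avgc a); apply: lee_wpmul2l => //; apply: le_integral => // y.
  by rewrite inE /= lee_fin => /uab/andP[].
rewrite -(avgc b); apply: lee_wpmul2l => //; apply: le_integral => // y.
by rewrite inE /= lee_fin => /uab/andP[].
Qed.

(** Averages over small balls lie between the extreme values of u on them. *)
Lemma lebesgue_representative_continuous (u : 'rV[R]_n -> R) : continuous u ->
  lebesgue_representative u = EFin \o u.
Proof.
move=> cu; apply/funext => x /=.
have near_u (e : R) : 0 < e -> \forall r \near 0^'+,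
    ((u x - e)%:E <= average (eball x r) (fun y => (u y)%:E) <= (u x + e)%:E)%E.
  move=> e0.
  have /cvgrPdist_le/(_ _ e0)/nbhs_ballP[d /= d0 ud] := cu x.
  near=> r; apply: average_bounds => // y xy.
  have /ud : ball x d y.
    rewrite mx_norm_ball /ball_/= distrC.
    apply: (le_lt_trans (norm_le_enorm _)); apply: (lt_le_trans xy).
    by near: r; exact: nbhs_right_le.
  by rewrite /= distrC ler_distl.
apply/eqP; rewrite eq_le; apply/andP; split.
  apply/lee_addgt0Pr => e e0; rewrite -EFinD.
  apply: le_trans (ereal_inf_lbound _) _; first by eexists; [exact: near_u e0|reflexivity].
  by apply: ge_ereal_sup => _ [r /andP[_ ru] <-].
apply/lee_subgt0Pr => e e0; rewrite -EFinB.
apply: le_ereal_inf_tmp => _ [V V0 <-].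
have [r Vr /andP[ur _]] : exists2 r, V r &
    ((u x - e)%:E <= average (eball x r) (fun y => (u y)%:E) <= (u x + e)%:E)%E.
  by have [r [Vr ur]] := filter_ex (filterI V0 (near_u e e0)); exists r.
by apply: le_trans ur _; apply: ereal_sup_ubound; exists r.
Unshelve. all: by end_near. Qed.

End enorm_theory.

(** * Weights *)

Section weights.
Context {R : realType} {n : nat}.
Variable w : 'rV[R]_n -> R.
Hypotheses (w0 : forall x, 0 <= w x) (wL1 : locally_L1 w)
  (wpos : {ae lebesgue_rV n, forall x, 0 < w x}).

Lemma weight_borel : exists v : 'rV[R]_n -> R,
  [/\ measurable_fun setT v, forall x, 0 <= v x &
      {ae lebesgue_rV n, forall x, w x = v x}].
Proof.
have [[v mv wv] _] := wL1; exists (fun x => `|v x|); split => //.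
  exact: measurableT_comp.
by apply: filterS wv => x wv; rewrite -wv ger0_norm.
Qed.

Lemma weight_measure_lty (A : set 'rV[R]_n) (M : R) :
  measurable A -> (forall x, A x -> `|x| <= M) -> (weight_measure w A < +oo)%E.
Proof.
move=> mA AM; have [_ /(_ _ (@compact_ball_rV _ _ M))] := wL1.
apply: le_lt_trans; rewrite /weight_measure.
rewrite integral_mkcond [leRHS]integral_mkcond.
apply: ge0_le_integral_ae.
- by move=> x; apply: erestrict_ge0 => y _; rewrite lee_fin.
- by move=> x; apply: erestrict_ge0.
apply: aeW => x _; rewrite /patch.
case: ifPn => [/set_mem/AM xM|_].
  by rewrite mem_set//= lee_fin ler_norm.
by case: ifP => // _; rewrite lee_fin.
Qed.

(** If the integral of w over A vanished, w would vanish almost everywhere on A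
    and be positive almost everywhere, so A would be a null set. *)
Lemma weight_measure_gt0 (A : set 'rV[R]_n) :
  measurable A -> (0 < lebesgue_rV n A)%E -> (0 < weight_measure w A)%E.
Proof.
move=> mA A0; have [v [mv v0 wv]] := weight_borel.
have wE : weight_measure w A = (\int[lebesgue_rV n]_(x in A) `|(v x)%:E|)%E.
  apply: ge0_eq_integral_ae => [x|x|]; [by rewrite lee_fin|exact: abse_ge0|].
  by apply: filterS wv => x -> _; rewrite /= ger0_norm.
rewrite lt_neqAle wE integral_ge0// andbT; apply/eqP => /esym.
have mvA : measurable_fun A (EFin \o v).
  by apply: measurable_funTS; exact/measurable_EFinP.
move/(ae_eq_integral_abs _ mA mvA) => vA0.
have [N [mN N0 NA]] : (lebesgue_rV n).-negligible A.
  refine (negligibleS _ (filterI (filterI wv wpos) vA0)).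
  move=> x Ax [[wvx wx] vx]; have /= := vx Ax.
  by move=> -[] vx0; move: wx; rewrite wvx vx0 ltxx.
have N0' : lebesgue_rV n N = 0%E := N0.
suff : (lebesgue_rV n A <= lebesgue_rV n N)%E by rewrite N0' leNgt A0.
by apply: le_measure; rewrite ?inE.
Qed.

Lemma weight_measure_finpos (A : set 'rV[R]_n) (M : R) :
  measurable A -> (forall x, A x -> `|x| <= M) -> (0 < lebesgue_rV n A)%E ->
  exists2 m : R, 0 < m & weight_measure w A = m%:E.
Proof.
move=> mA AM A0; have := weight_measure_gt0 mA A0.
have := weight_measure_lty mA AM.
by case: (weight_measure w A) => // m _ m0; exists m.
Qed.

End weights.

(** * Locally finite sums of C1 functions in the weighted Sobolev space *)

Section locally_finite_sums.
Context {R : realType} {n : nat}.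
Implicit Types (x y : 'rV[R]_n) (k N : nat).

Definition locally_finite {V : nmodType} (F : nat -> 'rV[R]_n -> V) : Prop :=
  forall k x, enorm x < k%:R -> F k x = 0.

(** The sum is cut at the first integer beyond |x|; by local finiteness any later
    cut gives the same value, so one cut serves a whole neighbourhood of x. *)
Definition locally_finite_sum {V : nmodType} (F : nat -> 'rV[R]_n -> V) x : V :=
  \sum_(0 <= k < (Num.truncn (enorm x)).+1) F k x.

Lemma locally_finite_sumE (V : nmodType) (F : nat -> 'rV[R]_n -> V) N x :
  locally_finite F -> enorm x < N%:R ->
  locally_finite_sum F x = \sum_(0 <= k < N) F k x.
Proof.
move=> F0 xN; rewrite /locally_finite_sum.
have tN : ((Num.truncn (enorm x)).+1 <= N)%N by rewrite truncn_lt_nat ?enorm_ge0.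
rewrite [RHS](big_cat_nat (n := (Num.truncn (enorm x)).+1))//=.
rewrite [X in _ = _ + X]big1_seq ?addr0// => k /andP[_].
rewrite mem_index_iota => /andP[tk _]; apply: F0.
by rewrite (lt_le_trans (truncnS_gt _))// ler_nat.
Qed.

Lemma near_enorm_lt x : \forall y \near x, enorm y < (Num.truncn (enorm x)).+1%:R.
Proof.
have cx : enorm y @[y --> x] --> enorm x by exact: enorm_continuous.
by apply: (cvgr_lt _ cx); exact: truncnS_gt.
Qed.

Lemma locally_finite_sum_continuous (F : nat -> 'rV[R]_n -> R) :
  locally_finite F -> (forall k, continuous (F k)) ->
  continuous (locally_finite_sum F).
Proof.
move=> F0 cF x; set N := (Num.truncn (enorm x)).+1.
have FE y : enorm y < N%:R -> locally_finite_sum F y = \sum_(0 <= k < N) F k y.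
  exact: locally_finite_sumE.
rewrite /continuous_at FE ?truncnS_gt//.
have := continuous_big_sum (s := index_iota 0 N) cF (x := x).
apply: cvg_trans; apply: (@near_eq_cvg _ _ (nbhs x)).
by near=> y; rewrite FE//; near: y; exact: near_enorm_lt.
Unshelve. all: by end_near.
Qed.

Lemma is_derive_big_sum (I : Type) (s : seq I) (F : I -> R -> R) (dF : I -> R) (t : R) :
  (forall j, is_derive t 1 (F j) (dF j)) ->
  is_derive t 1 (fun r => \sum_(k <- s) F k r) (\sum_(k <- s) dF k).
Proof.
move=> dFk; elim: s => [|k s IH].
  by under [X in is_derive _ _ X _]eq_fun do rewrite big_nil; rewrite big_nil;
    exact: is_derive_cst.
under [X in is_derive _ _ X _]eq_fun do rewrite big_cons.
by rewrite big_cons; exact: is_deriveD.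
Qed.

Lemma C1_locally_finite_sum (U : nat -> 'rV[R]_n -> R) G :
  locally_finite U -> locally_finite G -> (forall k, C1_gradient (U k) (G k)) ->
  C1_gradient (locally_finite_sum U) (locally_finite_sum G).
Proof.
move=> U0 G0 UG; split.
- by apply: locally_finite_sum_continuous => // k; have [] := UG k.
- move=> i; rewrite (_ : (fun x => _) =
      locally_finite_sum (fun k x => G k x ord0 i)).
    apply: locally_finite_sum_continuous => [k x xk|k].
      by rewrite G0// mxE.
    by have [_ + _] := UG k; exact.
  by apply/funext => x; rewrite /locally_finite_sum summxE.
- move=> i x s; set y := x + s *: _.
  set N := (Num.truncn (enorm y)).+1.
  rewrite (locally_finite_sumE (N := N))// ?truncnS_gt//.
  apply: (@near_eq_is_derive _ _ _
      (fun r : R => \sum_(0 <= k < N) U k (x + r *: delta_mx ord0 i))).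
    have cl : {for s, continuous (fun r : R => enorm (x + r *: delta_mx ord0 i))}.
      exact: (continuous_line (@enorm_continuous R n)).
    have near_s : \forall r \near s, enorm (x + r *: delta_mx ord0 i) < N%:R.
      by apply: (cvgr_lt _ cl); exact: truncnS_gt.
    by apply: filterS near_s => r rN; rewrite (locally_finite_sumE U0 rN).
  rewrite summxE; apply: is_derive_big_sum => k.
  by have [_ _] := UG k; exact.
Qed.

End locally_finite_sums.

Section sobolev_sums.
Context {R : realType} {n : nat}.
Variables (p : R) (w : 'rV[R]_n -> R).
Hypotheses (p1 : 1 <= p) (w0 : forall x, 0 <= w x) (wL1 : locally_L1 w).

Lemma C1_locally_Lp (u : 'rV[R]_n -> R) : continuous u -> locally_Lp p w u.
Proof.
move=> cu; have mu := continuous_measurable_rV cu; split.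
  by exists u => //; exact: aeW.
move=> K cK; have [M M0 uM] := continuous_compact_bounded cu cK.
have [v [mv v0 wv]] := weight_borel w0 wL1.
have mK := compact_measurable_rV cK.
apply: (@le_lt_trans _ _ (\int[lebesgue_rV n]_(x in K) ((M `^ p)%:E * (v x)%:E))%E).
  rewrite integral_mkcond [leRHS]integral_mkcond.
  apply: ge0_le_integral_ae.
  - by move=> x; apply: erestrict_ge0 => y _; rewrite lee_fin mulr_ge0// powR_ge0.
  - by move=> x; apply: erestrict_ge0 => y _; rewrite -EFinM lee_fin mulr_ge0// powR_ge0.
  apply: filterS wv => x wvx _; rewrite /patch; case: ifPn => // /set_mem Kx.
  rewrite -EFinM lee_fin wvx ler_wpM2r// ge0_ler_powR ?nnegrE ?(le_trans ler01 p1)//.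
  exact: uM.
rewrite ge0_integralZl_EFin ?powR_ge0//; last 2 first.
- by move=> x _; rewrite lee_fin.
- by apply: measurable_funTS; exact/measurable_EFinP.
apply: lte_mul_pinfty; rewrite ?lee_fin ?powR_ge0//.
have [_ /(_ _ cK)] := wL1; apply: le_lt_trans.
apply: ge0_le_integral_ae => [x|x|]; [by rewrite lee_fin|by []|].
by apply: filterS wv => x -> _; rewrite lee_fin ler_norm.
Qed.

(** At every point at most one of the gradients [G k] is nonzero, so the energy
    of the sum is the sum of the energies. *)
Lemma sobolev_locally_finite_sum (U : nat -> 'rV[R]_n -> R) G
    (E : nat -> set 'rV[R]_n) (c m : nat -> R) (B : R) :
  locally_finite U -> locally_finite G -> (forall k, C1_gradient (U k) (G k)) ->
  (forall x j k, G j x != 0 -> G k x != 0 -> j = k) ->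
  (forall k, measurable (E k)) ->
  (forall k x, G k x != 0 -> E k x) ->
  (forall k x i, `|G k x ord0 i| <= c k) ->
  (forall k, weight_measure w (E k) = (m k)%:E) ->
  (forall N, \sum_(0 <= k < N) (c k `^ p * m k) <= B) ->
  homogeneous_sobolev p w (locally_finite_sum U).
Proof.
move=> U0 G0 UG Gdisj mE GE Gc wE cB.
have UG' := C1_locally_finite_sum U0 G0 UG.
split; first by apply: C1_locally_Lp; have [] := UG'.
exists (locally_finite_sum G); first exact: C1_distributional_gradient.
have c0 k (i : 'I_n) : 0 <= c k := le_trans (normr_ge0 _) (Gc k 0 i).
have p0 : p != 0 by rewrite gt_eqF// (lt_le_trans ltr01).
(* A compares the Euclidean norm with the largest coordinate *)
pose A := Num.sqrt n%:R : R.
have [v [mv v0 wv]] := weight_borel w0 wL1.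
pose h k x := (((A * c k) `^ p)%:E * (\1_(E k) x * v x)%:E)%E.
have h0 k x : (0 <= h k x)%E.
  by rewrite /h -EFinM lee_fin mulr_ge0 ?powR_ge0// mulr_ge0// indicE.
have mIv k : measurable_fun setT (fun x => (\1_(E k) x * v x)%:E).
  by apply/measurable_EFinP; apply: measurable_funM => //; exact: measurable_indic.
have mh k : measurable_fun setT (h k).
  by apply: emeasurable_funM => //; exact: measurable_cst.
apply: (@le_lt_trans _ _ (\int[lebesgue_rV n]_x (\sum_(0 <= k <oo) h k x))%E).
  apply: ge0_le_integral_ae.
  - by move=> x; rewrite lee_fin mulr_ge0// powR_ge0.
  - by move=> x; exact: nneseries_ge0.
  apply: filterS wv => x wvx _.
  have [->|] := eqVneq (locally_finite_sum G x) 0.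
    by rewrite enorm0 powR0// mul0r; exact: nneseries_ge0.
  set N := (Num.truncn (enorm x)).+1.
  rewrite /locally_finite_sum => Gx.
  have [k kN Gkx] : exists2 k, (k < N)%N & G k x != 0.
    apply: contrapT => H; move/eqP: Gx; apply; rewrite big1_seq// => k.
    rewrite mem_index_iota => /andP[_ kN]; apply: contrapT => /eqP Gk.
    by apply: H; exists k.
  rewrite (bigD1_seq k) ?mem_index_iota ?iota_uniq//= big1 ?addr0; last first.
    move=> j jk; apply: contrapT => /eqP Gj; move/eqP: jk; apply.
    exact: Gdisj Gj Gkx.
  apply: (@le_trans _ _ (h k x)).
    rewrite /h -EFinM lee_fin indicE mem_set ?mul1r; last exact: GE.
    rewrite wvx ler_wpM2r//.
    have n0 : exists i : 'I_n, True.
      apply: contrapT => /forallNP H; move/eqP: Gkx; apply.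
      by apply/rowP => i; case: (H i).
    have [i _] := n0.
    rewrite ge0_ler_powR ?nnegrE ?(le_trans ler01 p1) ?enorm_ge0//.
      by rewrite mulr_ge0 ?sqrtr_ge0//; exact: c0 i.
    by apply: enorm_le; [exact: Gc|exact: c0 i].
  apply: le_trans (nneseries_lim_ge k.+1 _) => //.
  by rewrite big_nat_recr//= leeDr// sume_ge0.
rewrite integral_nneseries//.
have hE k : (\int[lebesgue_rV n]_x h k x = ((A * c k) `^ p * m k)%:E)%E.
  rewrite ge0_integralZl_EFin ?powR_ge0//; last first.
    by move=> x _; rewrite lee_fin mulr_ge0// indicE.
  rewrite EFinM -wE; congr (_ * _)%E.
  rewrite /weight_measure [RHS]integral_mkcond.
  apply: ge0_eq_integral_ae.
  - by move=> x; rewrite lee_fin mulr_ge0// indicE.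
  - by move=> x; apply: erestrict_ge0 => y _; rewrite lee_fin.
  apply: filterS wv => x wvx _; rewrite /patch indicE.
  by case: ifP; rewrite ?mul1r ?mul0r ?wvx.
apply: (@le_lt_trans _ _ (A `^ p * B)%:E); last exact: ltry.
apply: lime_le.
  by apply: is_cvg_nneseries => k _ _; exact: integral_ge0.
near=> N; under eq_bigr do rewrite hE.
rewrite sumEFin lee_fin.
have [n0|n0] := posnP n.
  rewrite big1 ?mulr_ge0 ?powR_ge0//.
    by have := cB 0%N; rewrite big_geq.
  by move=> k _; rewrite /A n0 sqrtr0 mul0r powR0// mul0r.
under eq_bigr do rewrite powRM ?sqrtr_ge0 ?(c0 _ (Ordinal n0))// -mulrA.
by rewrite -mulr_sumr ler_wpM2l// powR_ge0.
Unshelve. all: by end_near. Qed.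

End sobolev_sums.

(** * Smooth steps and selection of sequences *)

Section smooth_step.
Context {R : realType}.
Implicit Types t : R.

Let sqpos t : R := Num.max t 0 ^+ 2.
Let dsqpos t : R := 2 * Num.max t 0.

Let dsqpos_continuous : continuous dsqpos.
Proof.
move=> t; apply: cvgM; first exact: cvg_cst.
by apply: (@continuous_max _ _ (fun x : R => x) (fun=> 0)) => ?;
  [exact: cvg_id|exact: cvg_cst].
Qed.

Let sqpos_derive t : is_derive t 1 sqpos (dsqpos t).
Proof.
rewrite /dsqpos; have [t0|t0|->] := ltgtP t 0.
- apply: (@near_eq_is_derive _ _ _ (cst 0)).
    by apply: filterS (lt_nbhsl t0) => s s0; rewrite /sqpos max_r ?expr0n ?ltW.
  by rewrite mulr0; exact: is_derive_cst.
- apply: (@near_eq_is_derive _ _ _ (fun s : R => s ^+ 2)).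
    by apply: filterS (lt_nbhsr t0) => s s0; rewrite /sqpos max_l ?ltW.
  by apply: is_derive_eq; rewrite /GRing.scale/=; ring.
- have dq : (fun h : R => h^-1 *: ((sqpos \o shift 0) (h *: 1) - sqpos 0)) @ 0^' --> 0.
    apply/cvgr0Pnorm_le => e e0.
    near=> h; rewrite /sqpos /= maxxx expr0n subr0 addr0 [h *: 1]mulr1.
    have [h0|h0] := leP h 0; first by rewrite expr0n scaler0 normr0 ltW.
    rewrite /GRing.scale/= expr2 mulKf ?gt_eqF//.
    near: h; apply: dnbhs0_le; exact: e0.
  rewrite mulr0; apply: DeriveDef; first by apply/cvg_ex; exists 0.
  exact: cvg_lim dq.
Unshelve. all: by end_near. Qed.

(** The quotient P / (P + Q) of the squared positive parts P of t and Q of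
    1 - t: these are C1 and have no common zero. *)
Lemma smooth_step : exists psi dpsi : R -> R, exists2 C : R,
  (forall t, `|dpsi t| <= C) &
  [/\ forall t, is_derive t 1 psi (dpsi t), continuous dpsi,
      forall t, t <= 0 -> psi t = 0 /\ dpsi t = 0,
      forall t, 1 <= t -> psi t = 1 /\ dpsi t = 0 &
      forall t, 0 < t < 1 -> 0 < psi t < 1].
Proof.
pose P := sqpos; pose Q t := sqpos (1 - t).
have P0 t : 0 <= P t by exact: sqr_ge0.
have Q0 t : 0 <= Q t by exact: sqr_ge0.
have Pgt0 t : 0 < t -> 0 < P t by move=> t0; rewrite /P /sqpos max_l ?exprn_gt0 ?ltW.
have PQ t : 0 < P t + Q t.
  have [t0|t0] := ltP 0 t; first by rewrite ltr_pwDl// Pgt0.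
  by rewrite ltr_wpDl// /Q; apply: Pgt0; lra.
have dP t : is_derive t 1 P (dsqpos t) by exact: sqpos_derive.
have dQ t : is_derive t 1 Q (- dsqpos (1 - t)).
  have d1t : is_derive t 1 (fun t => 1 - t) (- 1 : R).
    by apply: is_derive_eq; rewrite add0r mul1r.
  have := @is_derive1_comp _ sqpos (fun t => 1 - t) t _ _
    (sqpos_derive (1 - t)) d1t.
  by rewrite mulrN1.
pose dpsi t := (dsqpos t * Q t + P t * dsqpos (1 - t)) / ((P t + Q t) * (P t + Q t)).
have cP : continuous P := is_derive1_continuous dP.
have cQ : continuous Q := is_derive1_continuous dQ.
have cd1 : continuous (fun t => dsqpos (1 - t)).
  move=> t; apply: (@continuous_comp _ _ _ (fun t => 1 - t) dsqpos).
    by apply: cvgB; [exact: cvg_cst|exact: cvg_id].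
  exact: dsqpos_continuous.
have cd : continuous dpsi.
  move=> t; apply: cvgM.
    by apply: cvgD; apply: cvgM; [exact: dsqpos_continuous|exact: cQ|exact: cP|exact: cd1].
  apply: cvgV; first by rewrite mulf_neq0// gt_eqF.
  by apply: cvgM; apply: cvgD; [exact: cP|exact: cQ|exact: cP|exact: cQ].
have d0 t : t <= 0 -> dpsi t = 0.
  move=> t0; rewrite /dpsi /P /sqpos /dsqpos max_r// expr0n/= mulr0 !mul0r.
  by rewrite addr0 mul0r.
have d1 t : 1 <= t -> dpsi t = 0.
  move=> t1; rewrite /dpsi /Q /sqpos /dsqpos (@max_r _ _ (1 - t)) ?subr_le0//.
  by rewrite expr0n/= mulr0 !mulr0 addr0 mul0r.
have [c _ cmax] : exists2 c : R, c \in `[0, 1]%R &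
    forall t, t \in `[0, 1]%R -> `|dpsi t| <= `|dpsi c|.
  apply: EVT_max; rewrite ?ler01//.
  apply: continuous_subspaceT => t.
  by apply: continuous_comp; [exact: cd|exact: norm_continuous].
exists (fun t => P t / (P t + Q t)), dpsi, `|dpsi c|; last split => //.
- move=> t; have [t0|t0] := leP t 0; first by rewrite d0// normr0.
  have [t1|t1] := leP 1 t; first by rewrite d1// normr0.
  by apply: cmax; rewrite in_itv/= !ltW.
- move=> t.
  have PQt : P t + Q t != 0 by rewrite gt_eqF.
  have dPQ : is_derive t 1 (fun s => P s + Q s) (dsqpos t - dsqpos (1 - t)).
    exact: is_deriveD.
  have dV : is_derive t 1 (fun s => (P s + Q s)^-1)
      (- (P t + Q t) ^- 2 *: (dsqpos t - dsqpos (1 - t))).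
    exact: is_deriveV.
  have := is_deriveM (dP t) dV.
  move=> H; apply: (@is_derive_eq _ _ _ _ _ _ _ _ H).
  rewrite /GRing.scale/= /dpsi.
  by field.
- by move=> t t0; split; [rewrite /P /sqpos max_r// expr0n mul0r|exact: d0].
- move=> t t1; split; last exact: d1.
  have Qt : Q t = 0 by rewrite /Q /sqpos max_r ?expr0n// subr_le0.
  by rewrite Qt addr0 divff// gt_eqF// Pgt0// (lt_le_trans ltr01).
- move=> t /andP[t0 t1]; have Qt : 0 < Q t by apply: Pgt0; rewrite subr_gt0.
  by rewrite divr_gt0 ?Pgt0//= ltr_pdivrMr// mul1r ltrDl.
Qed.

(** The product psi (1 - psi) for a smooth step psi. *)
Lemma smooth_bump : exists theta dtheta : R -> R, exists2 C : R,
  (forall t, `|dtheta t| <= C) &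
  [/\ forall t, is_derive t 1 theta (dtheta t), continuous dtheta,
      forall t, (t <= 0) || (1 <= t) -> theta t = 0 /\ dtheta t = 0,
      forall t, 0 < t < 1 -> 0 < theta t &
      forall t, 0 <= theta t <= 1].
Proof.
have [psi [dpsi [C dC [dpsiE cdpsi psi0 psi1 psi01]]]] := smooth_step.
have psi_bnd t : 0 <= psi t <= 1.
  have [/psi0[-> _]|t0] := leP t 0; first by rewrite lexx ler01.
  have [/psi1[-> _]|t1] := leP 1 t; first by rewrite lexx ler01.
  by have /andP[/ltW -> /ltW ->] : 0 < psi t < 1 by apply: psi01; rewrite t0 t1.
have cpsi : continuous psi := is_derive1_continuous dpsiE.
exists (fun t => psi t * (1 - psi t)), (fun t => dpsi t * (1 - 2 * psi t)), C.
  move=> t; rewrite normrM -[leRHS]mulr1 ler_pM//.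
  by have /andP[? ?] := psi_bnd t; rewrite ler_norml; apply/andP; split; lra.
split.
- move=> t; have := dpsiE t => ?.
  by apply: is_derive_eq; rewrite /GRing.scale/=; ring.
- apply: continuous_mul => // t; apply: cvgB; first exact: cvg_cst.
  by apply: cvgM; [exact: cvg_cst|exact: cpsi].
- move=> t /orP[/psi0[-> ->]|/psi1[-> ->]]; first by rewrite !mul0r.
  by rewrite subrr mulr0 mul0r.
- by move=> t /psi01/andP[t0 t1]; rewrite mulr_gt0// subr_gt0.
- move=> t; have /andP[t0 t1] := psi_bnd t.
  by rewrite mulr_ge0 ?subr_ge0//= mulr_ile1 ?subr_ge0// gerBl.
Qed.

End smooth_step.

Section sequence_selection.
Context {R : realType}.

(** Greedy choice: an index is retained when the value there is at most half of
    the last retained value, so that the retained values telescope. *)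
Lemma summable_subsequence (m : nat -> R) :
  (forall k, 0 < m k) -> (forall e, 0 < e -> exists k, m k < e) ->
  exists S : nat -> bool, (forall N, exists2 k, (N <= k)%N & S k) /\
    forall N, \sum_(0 <= k < N) ((S k)%:R * m k) <= 1.
Proof.
move=> m0 minf.
(* r k is the last value retained before k; the retained values before N sum to
   at most 1 - r N *)
pose fix r k : R := if k is j.+1 then
  if m j <= r j / 2 then m j else r j else 1.
have r0 k : 0 < r k by elim: k => [|k IH] //=; case: ifP.
exists (fun k => m k <= r k / 2); split => [N|N]; last first.
  suff : \sum_(0 <= k < N) ((m k <= r k / 2)%R%:R * m k) <= 1 - r N.
    by move=> /le_trans; apply; rewrite gerBl ltW.
  elim: N => [|N IH]; first by rewrite big_geq//= subrr.
  rewrite big_nat_recr//=; case: ifPn => mr; rewrite ?mul1r ?mul0r ?addr0//.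
  by lra.
have [e e0 eN] : exists2 e : R, 0 < e & forall k, (k < N)%N -> e <= m k.
  elim: {r r0} N => [|N [e e0 eN]]; first by exists 1.
  exists (Num.min e (m N)); first by rewrite lt_min e0 m0.
  move=> k; rewrite ltnS leq_eqVlt => /orP[/eqP->|/eN ek].
    by rewrite ge_min lexx orbT.
  by rewrite ge_min ek.
apply: contrapT => noS.
have rE k : (N <= k)%N -> r k = r N.
  elim: k => [|k IH]; first by rewrite leqn0 => /eqP ->.
  rewrite leq_eqVlt => /orP[/eqP -> //|]; rewrite ltnS => Nk /=.
  by case: ifPn => mr; [exfalso; apply: noS; exists k|exact: IH].
have er0 : 0 < Num.min e (r N / 2) by rewrite lt_min e0 divr_gt0.
have [k] := minf _ er0.
rewrite lt_min => /andP[ke kr].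
have Nk : (N <= k)%N by rewrite leqNgt; apply/negP => /eN; rewrite leNgt ke.
by apply: noS; exists k => //; rewrite rE// ltW.
Qed.

(** Dini: dividing the terms of a divergent series by its partial sums S_k
    leaves a divergent series, while dividing by S_k ^ p gives a convergent one,
    by comparison with the telescoping series of S_k ^ (1 - p). *)
Lemma divergent_series_refinement (p : R) (lam : nat -> R) : 1 < p ->
  (forall k, 0 < lam k) ->
  (forall M, exists N, M <= \sum_(0 <= k < N) lam k) ->
  exists b : nat -> R, [/\ forall k, 0 <= b k,
    forall M, exists N, M <= \sum_(0 <= k < N) b k &
    exists B, forall N, \sum_(0 <= k < N) (b k `^ p * lam k `^ (1 - p)) <= B].
Proof.
move=> p1 lam0 lamoo.
pose S N := \sum_(0 <= k < N) lam k.
have SS N : S N.+1 = S N + lam N by rewrite /S big_nat_recr.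
have S0 N : 0 < S N.+1.
  elim: N => [|N IH]; rewrite SS; last exact: addr_gt0.
  by rewrite /S big_geq// add0r.
have p10 : 0 < p - 1 by rewrite subr_gt0.
exists (fun k => lam k / S k.+1); split.
- by move=> k; rewrite divr_ge0 ?ltW.
- have ndS j N : (j <= N)%N -> S j <= S N.
    elim: N => [|N IH]; first by rewrite leqn0 => /eqP ->.
    rewrite leq_eqVlt => /orP[/eqP -> //|]; rewrite ltnS => /IH /le_trans; apply.
    by rewrite SS lerDl ltW.
  (* the terms between N and an index N' at which the partial sums have doubled
     add up to at least (S N' - S N) / S N' >= 1 / 2 *)
  have block N : exists N', \sum_(0 <= k < N) (lam k / S k.+1) + 2^-1 <=
      \sum_(0 <= k < N') (lam k / S k.+1).
    have [N' NN'] := lamoo (2 * S N.+1).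
    have SN' : 2 * S N.+1 <= S N' by [].
    have NltN' : (N < N')%N.
      rewrite ltnNge; apply/negP => /ndS H.
      have := S0 N; have : S N <= S N.+1 by exact: ndS.
      lra.
    exists N'; rewrite (big_cat_nat (n := N) (m := 0%N) (p := N'))//=; last exact: ltnW.
    rewrite lerD2l.
    have E : (S N' - S N) / S N' <= \sum_(N <= k < N') (lam k / S k.+1).
      rewrite {1}/S (big_cat_nat (n := N) (m := 0%N) (p := N'))//= ?(ltnW NltN')//.
      rewrite addrAC subrr add0r mulr_suml.
      apply: ler_sum_nat => k /andP[_ kN'].
      apply: ler_wpM2l; first exact/ltW.
      by rewrite lef_pV2 ?posrE ?(lt_le_trans (S0 k))// ndS.
    apply: le_trans E; have SN'0 : 0 < S N' by rewrite (lt_le_trans (S0 N))// ndS.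
    rewrite ler_pdivlMr//; have : S N <= S N.+1 by exact: ndS.
    lra.
  move=> M.
  have H j : exists N, j%:R / 2 <= \sum_(0 <= k < N) (lam k / S k.+1).
    elim: j => [|j [N jN]]; first by exists 0%N; rewrite big_geq// mul0r.
    have [N' NN'] := block N; exists N'; apply: le_trans NN'.
    by rewrite -natr1 mulrDl div1r lerD2r.
  have [N HN] := H (Num.truncn (2 * `|M|)).+1; exists N; apply: le_trans HN.
  rewrite ler_pdivlMr// mulrC (le_trans _ (ltW (truncnS_gt _)))//.
  by rewrite ler_wpM2l// ler_norm.
  (* the inequality 1 - x <= (x ^ (1 - p) - 1) / (p - 1) at the ratio x of two
     successive partial sums bounds each term by a telescoping difference *)
- have step N : (lam N.+1 / S N.+2) `^ p * lam N.+1 `^ (1 - p) <=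
      (p - 1)^-1 * (S N.+1 `^ (1 - p) - S N.+2 `^ (1 - p)).
    have l0 := lam0 N.+1; have s1 := S0 N; have s2 := S0 N.+1.
    rewrite ler_pdivlMl//.
    have -> : (lam N.+1 / S N.+2) `^ p * lam N.+1 `^ (1 - p) =
        S N.+2 `^ (1 - p) * (lam N.+1 / S N.+2).
      have q0 : 0 < lam N.+1 / S N.+2 by rewrite divr_gt0.
      have -> : lam N.+1 `^ (1 - p) =
          (lam N.+1 / S N.+2) `^ (1 - p) * S N.+2 `^ (1 - p).
        by rewrite -powRM ?divfK ?gt_eqF// ltW.
      rewrite mulrA -powRD; last by rewrite (gt_eqF q0) implybT.
      by rewrite addrC subrK powRr1 ?ltW// mulrC.
    have -> : S N.+1 `^ (1 - p) = S N.+2 `^ (1 - p) * (S N.+1 / S N.+2) `^ (1 - p).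
      rewrite -powRM; [|exact: ltW|by rewrite ltW ?divr_gt0].
      by rewrite mulrC divfK// gt_eqF.
    rewrite mulrCA -[X in _ <= _ - X]mulr1 -mulrBr ler_wpM2l ?powR_ge0//.
    set x := S N.+1 / S N.+2; have x0 : 0 < x by rewrite divr_gt0.
    have -> : lam N.+1 / S N.+2 = 1 - x.
      rewrite /x (SS N.+1); rewrite SS in s2; field.
      by rewrite gt_eqF// -SS.
    rewrite /powR gt_eqF//.
    have := expR_ge1Dx ((1 - p) * ln x).
    have : ln x <= x - 1.
      have := @le_ln1Dx R (x - 1); rewrite [1 + _]addrC subrK; apply; lra.
    nra.
  exists ((lam 0%N / S 1%N) `^ p * lam 0%N `^ (1 - p) +
    (p - 1)^-1 * S 1%N `^ (1 - p)) => N.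
  pose T k := (lam k / S k.+1) `^ p * lam k `^ (1 - p).
  rewrite -/(T 0%N) (eq_bigr T)//.
  have T0 k : 0 <= T k by rewrite mulr_ge0 ?powR_ge0.
  apply: (@le_trans _ _ (\sum_(0 <= k < N.+1) T k)).
    by rewrite big_nat_recr//= lerDl.
  suff : \sum_(0 <= k < N.+1) T k <=
      T 0%N + (p - 1)^-1 * (S 1%N `^ (1 - p) - S N.+1 `^ (1 - p)).
    move=> /le_trans; apply; rewrite lerD2l ler_wpM2l ?invr_ge0 ?(ltW p10)//.
    by rewrite gerBl powR_ge0.
  elim: N => [|N IH]; first by rewrite big_nat1 subrr mulr0 addr0.
  rewrite big_nat_recr//=; have := step N.
  rewrite -/(T N.+1) => H; apply: le_trans (lerD IH H) _.
  by rewrite -addrA -mulrDr addrA subrK.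
Qed.

End sequence_selection.

(** * Vertical limits and radial functions *)

Section vertical_limits.
Context {R : realType} {n : nat}.

(** The form in which an almost sure vertical limit is contradicted: it is reached
    above some point of each set of positive measure. *)
Lemma vertical_limit_at (u : 'rV[R]_n.+1 -> R) (Q : set 'rV[R]_n) :
  continuous u -> measurable Q -> (0 < lebesgue_rV n Q)%E ->
  unique_ae_vertical_limit (lebesgue_representative u) ->
  exists (x : 'rV[R]_n) (c : R), Q x /\ forall e, 0 < e ->
    exists T, forall t, T < t -> `|u (vjoin n.+1 x t) - c| < e.
Proof.
move=> cu mQ Q0 [c].
rewrite lebesgue_representative_continuous//= => limc.
have [x [Qx xc]] : exists x : 'rV[R]_n, Q x /\
    (u (vjoin n.+1 x t))%:E @[t --> +oo%R] --> c%:E.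
  apply: contrapT => /forallNP noQ.
  have [N [mN N0 NQ]] : (lebesgue_rV n).-negligible Q.
    by refine (negligibleS _ limc) => x Qx xc; apply: (noQ x).
  have N0' : lebesgue_rV n N = 0%E := N0.
  suff : (lebesgue_rV n Q <= lebesgue_rV n N)%E by rewrite N0' leNgt Q0.
  by apply: le_measure; rewrite ?inE.
exists x, c; split => // e e0.
move/fine_cvgP : xc => [_] /cvgrPdist_lt /(_ _ e0) [T [_ H]].
by exists T => t /H /=; rewrite distrC.
Qed.

End vertical_limits.

Section radial_functions.
Context {R : realType} {n : nat}.
Implicit Types (x : 'rV[R]_n) (k N : nat).

(** Affine in the squared norm, hence polynomial in the coordinates, and running
    from 0 to 1 across the k-th annulus. *)
Definition radial_step k x : R :=
  ((\sum_(i < n) x ord0 i ^+ 2) / (2 ^+ k) ^+ 2 - 1) / 3.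

Let pow2_gt0 k : 0 < (2 : R) ^+ k. Proof. by rewrite exprn_gt0. Qed.

Lemma radial_step_le0 k x : enorm x <= 2 ^+ k -> radial_step k x <= 0.
Proof.
move=> xk; rewrite /radial_step -sqr_enorm pmulr_lle0 ?invr_gt0// subr_le0.
rewrite ler_pdivrMr ?exprn_gt0// mul1r.
by rewrite lerXn2r ?nnegrE ?enorm_ge0 ?exprn_ge0.
Qed.

Lemma radial_step_ge1 k x : 2 ^+ k.+1 <= enorm x -> 1 <= radial_step k x.
Proof.
move=> xk; rewrite /radial_step -sqr_enorm ler_pdivlMr// mul1r.
rewrite lerBrDr ler_pdivlMr ?exprn_gt0//.
have -> : (3 + 1) * (2 ^+ k) ^+ 2 = ((2 : R) ^+ k.+1) ^+ 2 by rewrite [2 ^+ k.+1]exprS; ring.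
by rewrite lerXn2r ?nnegrE ?enorm_ge0 ?exprn_ge0.
Qed.

Lemma is_derive_sqnorm (i : 'I_n) x (s : R) :
  is_derive s 1 (fun r : R => \sum_(j < n) (x + r *: delta_mx ord0 i) ord0 j ^+ 2)
    (2 * (x + s *: delta_mx ord0 i) ord0 i).
Proof.
have := @is_derive_big_sum R 'I_n (index_enum _)
  (fun j r => (x + r *: delta_mx ord0 i) ord0 j ^+ 2)
  (fun j => 2 * (x + s *: delta_mx ord0 i) ord0 j * (j == i)%:R) s.
rewrite (bigD1 i)//= eqxx mulr1 big1 ?addr0; last first.
  by move=> j /negbTE ->; rewrite mulr0.
apply => j; under [X in is_derive _ _ X _]eq_fun do rewrite !mxE eqxx/=.
rewrite !mxE eqxx/=.
by apply: is_derive_eq; rewrite /GRing.scale/=; ring.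
Qed.

Lemma annulus_measurable k : measurable (@annulus R n k).
Proof.
rewrite (_ : annulus k = setT `&` @enorm R n @^-1` `[2 ^+ k, 2 ^+ k.+1[%classic).
  by apply: (continuous_measurable_rV (@enorm_continuous R n)) => //; exact: measurable_itv.
by apply/seteqP; split=> x /=; rewrite in_itv/=; [|case].
Qed.

Lemma annulus_bounded k x : annulus k x -> `|x| <= 2 ^+ k.+1.
Proof. by move=> /andP[_ /ltW]; apply: le_trans; exact: norm_le_enorm. Qed.

Lemma annulus_lebesgue_rV_gt0 k : (0 < n)%N -> (0 < lebesgue_rV n (@annulus R n k))%E.
Proof.
move=> n0; pose c : R := 3 / 2 * 2 ^+ k.
have k0 := pow2_gt0 k.
pose z : 'rV[R]_n := c *: delta_mx ord0 (Ordinal n0).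
have zc : enorm z = c.
  rewrite /enorm (bigD1 (Ordinal n0))//= big1 ?addr0.
    by rewrite !mxE !eqxx mulr1 sqrtr_sqr ger0_norm// /c; lra.
  by move=> j j0; rewrite !mxE (negbTE j0) andbF mulr0 expr0n.
pose U := @enorm R n @^-1` `]2 ^+ k, 2 ^+ k.+1[%classic.
have oU : open U.
  by have /continuousP cE := @enorm_continuous R n; apply: cE; exact: (@itv_open _ R).
apply: (@lt_le_trans _ _ (lebesgue_rV n U)).
  apply: (@open_lebesgue_rV_gt0 R n U z oU).
  by rewrite /U/= in_itv/= zc exprS /c; apply/andP; split; lra.
apply: le_measure; rewrite ?inE; [exact: open_measurable_rV|exact: annulus_measurable|].
by move=> x; rewrite /U /annulus/= in_itv/= => /andP[/ltW -> ->].
Qed.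

End radial_functions.

Section radial_part.
Context {R : realType} {n : nat}.
Variables (p : R) (w : 'rV[R]_n.+1 -> R).
Hypotheses (p1 : 1 <= p) (w0 : forall x, 0 <= w x) (wL1 : locally_L1 w).

(** The function increases by b_k across the k-th annulus, so it exceeds any given
    partial sum of b outside a ball. *)
Lemma radial_function_without_limit (m b : nat -> R) (B : R) :
  (forall k, weight_measure w (annulus k) = (m k)%:E) ->
  (forall k, 0 <= b k) ->
  (forall M, exists N, M <= \sum_(0 <= k < N) b k) ->
  (forall N, \sum_(0 <= k < N) ((b k / 2 ^+ k) `^ p * m k) <= B) ->
  exists2 u, homogeneous_sobolev p w u &
    ~ unique_ae_vertical_limit (lebesgue_representative u).
Proof.
move=> wE b0 boo bB.
have [psi [dpsi [C dC [dpsiE cdpsi psi0 psi1 psi01]]]] := @smooth_step R.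
have C0 : 0 <= C := le_trans (normr_ge0 _) (dC 0).
have cpsi : continuous psi := is_derive1_continuous dpsiE.
have psi_ge0 t : 0 <= psi t.
  have [/psi0[-> _]//|t0] := leP t 0.
  have [/psi1[-> _]//|t1] := leP 1 t.
  have : 0 < psi t < 1 by apply: psi01; rewrite t0 t1.
  by case/andP => /ltW.
have pow2_gt0 k : 0 < (2 : R) ^+ k by rewrite exprn_gt0.
pose U k (x : 'rV[R]_n.+1) := b k * psi (radial_step k x).
pose G k (x : 'rV[R]_n.+1) := \row_i (b k * (dpsi (radial_step k x) *
  (2 * x ord0 i / (2 ^+ k) ^+ 2 / 3))).
have k_le k : k%:R <= (2 : R) ^+ k by rewrite -natrX ler_nat ltnW// ltn_expl.
have cstep k : continuous (@radial_step R n.+1 k).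
  apply: continuous_mul; last exact: cst_continuous.
  have cq : continuous (fun x : 'rV[R]_n.+1 =>
      (\sum_(i < n.+1) x ord0 i ^+ 2) / (2 ^+ k) ^+ 2).
    by apply: continuous_mul; [exact: continuous_sqnorm|exact: cst_continuous].
  by move=> x; exact: cvgB (cq x) (cvg_cst _).
have U0 : locally_finite U.
  move=> k x xk; rewrite /U (psi0 _ _).1 ?mulr0// radial_step_le0//.
  exact: le_trans (ltW xk) (k_le k).
have G0 : locally_finite G.
  move=> k x xk; apply/rowP => i; rewrite !mxE (psi0 _ _).2 ?mul0r ?mulr0//.
  exact/radial_step_le0/(le_trans (ltW xk)).
have UG k : C1_gradient (U k) (G k).
  split.
  - apply: continuous_mul; first exact: cst_continuous.
    by move=> x; apply: (@continuous_comp _ _ _ (radial_step k) psi);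
      [exact: cstep|exact: cpsi].
  - move=> i; under eq_fun do rewrite mxE.
    apply: continuous_mul; first exact: cst_continuous.
    apply: continuous_mul.
      by move=> x; apply: (@continuous_comp _ _ _ (radial_step k) dpsi);
        [exact: cstep|exact: cdpsi].
    do 2![apply: continuous_mul; last exact: cst_continuous].
    by apply: continuous_mul; [exact: cst_continuous|exact: coord_continuous].
  - move=> i x s; rewrite mxE.
    have dstep : is_derive s 1 (fun r : R => radial_step k (x + r *: delta_mx ord0 i))
        (2 * (x + s *: delta_mx ord0 i) ord0 i / (2 ^+ k) ^+ 2 / 3).
      have dq := is_derive_sqnorm i x s.
      rewrite /radial_step.
      by apply: is_derive_eq; rewrite /GRing.scale/=; ring.
    have dcomp := @is_derive1_comp _ psi
      (fun r : R => radial_step k (x + r *: delta_mx ord0 i)) s _ _ (dpsiE _) dstep.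
    by apply: is_derive_eq; rewrite /GRing.scale/=; ring.
have GE k x : G k x != 0 -> 2 ^+ k < enorm x < 2 ^+ k.+1.
  move=> Gx; apply/andP; split; rewrite ltNge; apply/negP.
    move=> /radial_step_le0/psi0[_ d0]; move/eqP: Gx; apply; apply/rowP => i.
    by rewrite !mxE d0 mul0r mulr0.
  move=> /radial_step_ge1/psi1[_ d0]; move/eqP: Gx; apply; apply/rowP => i.
  by rewrite !mxE d0 mul0r mulr0.
have Gdisj x j k : G j x != 0 -> G k x != 0 -> j = k.
  have H i i' : (i < i')%N -> 2 ^+ i' < enorm x -> enorm x < 2 ^+ i.+1 -> False.
    move=> ii' x1 x2; have := lt_trans x1 x2.
    by rewrite ltNge ler_weXn2l ?ler1n.
  move=> /GE/andP[j1 j2] /GE/andP[k1 k2].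
  by case: (ltngtP j k) => // jk; exfalso; [exact: (H _ _ jk)|exact: (H _ _ jk)].
(* |x_i| <= 2 ^ (k + 1) on the annulus: the bound is C b_k (4 / 3) / 2 ^ k *)
pose c k := 2 * C * (b k / 2 ^+ k).
have Gc k x i : `|G k x ord0 i| <= c k.
  have c0 : 0 <= c k by rewrite /c !mulr_ge0// invr_ge0 ltW.
  have [->|Gx] := eqVneq (G k x) 0; first by rewrite mxE normr0.
  have /andP[_ /ltW x2] := GE _ _ Gx.
  have xi := le_trans (coord_le_enorm x i) x2.
  rewrite mxE normrM (ger0_norm (b0 k)) normrM /c.
  rewrite [X in _ <= X](_ : _ = b k * (C * (2 / 2 ^+ k))); last by ring.
  apply: ler_wpM2l => //; apply: ler_pM => //.
  have k0 := pow2_gt0 k.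
  rewrite (_ : _ / 3 = 2 / 2 ^+ k * (x ord0 i / (3 * 2 ^+ k))); last first.
    by field; rewrite gt_eqF.
  rewrite normrM ger0_norm; last by rewrite divr_ge0// ltW.
  rewrite ler_piMr ?divr_ge0 ?(ltW k0)//.
  rewrite normrM normfV (@ger0_norm _ (3 * _)) ?mulr_ge0 ?(ltW k0)//.
  rewrite ler_pdivrMr ?mulr_gt0// mul1r (le_trans xi)// exprS ler_wpM2r ?(ltW k0)//.
  lra.
exists (locally_finite_sum U).
  apply: (@sobolev_locally_finite_sum _ _ p w p1 w0 wL1 U G (@annulus R n.+1) c m
    ((2 * C) `^ p * B)) => //.
  - by move=> k; exact: annulus_measurable.
  - by move=> k x /GE/andP[/ltW x1 x2]; apply/andP.
  - move=> N; under eq_bigr do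
      rewrite /c powRM ?mulr_ge0 ?invr_ge0 ?(ltW (pow2_gt0 _))// -mulrA.
    by rewrite -mulr_sumr ler_wpM2l ?powR_ge0.
have [cU _ _] := C1_locally_finite_sum U0 G0 UG.
move=> /(vertical_limit_at cU (cube_measurable 0 1)) [].
  by rewrite lebesgue_rV_cube// lte_fin exprn_gt0.
move=> x [l [_ /(_ 1 ltr01)[T Tl]]].
have [N Nl] := boo (l + 1).
pose t := Num.max (T + 1) (2 ^+ N).
have tT : T < t by rewrite lt_max ltrDl ltr01.
have := Tl t tT; apply/negP; rewrite -leNgt; apply: le_trans (ler_norm _).
rewrite lerBrDr addrC; apply: (le_trans Nl).
set z := vjoin _ _ _.
have zN : 2 ^+ N <= enorm z.
  have := coord_le_enorm z ord_max; rewrite vjoin_last; apply: le_trans.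
  by rewrite (le_trans _ (ler_norm _))// le_max lexx orbT.
pose N' := maxn N (Num.truncn (enorm z)).+1.
rewrite (locally_finite_sumE (N := N') U0); last first.
  by rewrite (lt_le_trans (truncnS_gt _))// ler_nat leq_maxr.
rewrite (big_cat_nat (n := N) (m := 0%N) (p := N'))//= ?leq_maxl//.
rewrite -[leLHS]addr0 lerD//; last by apply: sumr_ge0 => k _; rewrite mulr_ge0.
apply: ler_sum_nat => k /andP[_ kN].
rewrite /U (psi1 _ _).1 ?mulr1//; apply: radial_step_ge1; apply: le_trans zN.
by rewrite ler_weXn2l ?ler1n.
Qed.

End radial_part.

(** * Slabs and oscillating functions *)

Section slabs.
Context {R : realType} {n : nat}.
Variables (a : 'rV[R]_n) (l : R).
Hypothesis l0 : 0 < l.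
Implicit Types (x : 'rV[R]_n.+1) (k : nat) (j : 'I_n.+1).

Definition slab k : set 'rV[R]_n.+1 :=
  [set vjoin n.+1 x t | x in cube a l & t in `[k%:R, k.+1%:R]%classic].

Definition slab_corner k : 'rV[R]_n.+1 := vjoin n.+1 a k%:R.

Definition slab_sides : 'rV[R]_n.+1 := vjoin n.+1 (const_mx l) 1.

Lemma ord_widen_max j : j = ord_max \/ exists i, j = widen_ord (leqnSn n) i.
Proof.
have [jn|nj] := ltnP j n; [right|left].
  by exists (Ordinal jn); exact/val_inj.
by apply/val_inj/eqP; rewrite /= eqn_leq nj -ltnS ltn_ord.
Qed.

Lemma slab_sides_gt0 j : 0 < slab_sides ord0 j.
Proof.
rewrite /slab_sides.
case: (ord_widen_max j) => [->|[i ->]]; first by rewrite vjoin_last ltr01.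
by rewrite vjoin_widen mxE.
Qed.

Lemma slab_topE k j : (slab_corner k + slab_sides) ord0 j =
  slab_corner k ord0 j + slab_sides ord0 j.
Proof. by rewrite [LHS]mxE. Qed.

Lemma slabE k : slab k = [set x | forall j,
  slab_corner k ord0 j <= x ord0 j <= (slab_corner k + slab_sides) ord0 j].
Proof.
apply/seteqP; split => [_ [x xQ [t + <-]] j|x xk].
  rewrite /= in_itv/= => tk; rewrite slab_topE /slab_corner /slab_sides.
  case: (ord_widen_max j) => [->|[i ->]].
    by rewrite !vjoin_last natr1.
  by rewrite !vjoin_widen mxE; exact: xQ.
exists (\row_(j < n) x ord0 (widen_ord (leqnSn n) j)).
  move=> j; rewrite mxE.
  have := xk (widen_ord (leqnSn n) j).
  by rewrite slab_topE /slab_corner /slab_sides !vjoin_widen mxE.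
exists (x ord0 ord_max); last exact: vjoinK.
have := xk ord_max.
by rewrite slab_topE /slab_corner /slab_sides !vjoin_last natr1 /= in_itv.
Qed.

Lemma slab_measurable k : measurable (slab k).
Proof. by rewrite slabE; exact: box_measurable. Qed.

Lemma slab_bounded k : exists M, forall x, slab k x -> `|x| <= M.
Proof.
pose r := `|slab_corner k| + `|slab_corner k + slab_sides|.
exists (Num.sqrt n.+1%:R * r) => x; rewrite slabE => xk.
apply: le_trans (norm_le_enorm x) _; apply: enorm_le; last by rewrite addr_ge0.
move=> j; have /andP[x1 x2] := xk j.
have := coord_le_norm (slab_corner k) j.
have := coord_le_norm (slab_corner k + slab_sides) j.
rewrite !ler_norml => /andP[? ?] /andP[? ?]; apply/andP; rewrite /r; split.
  have := normr_ge0 (slab_corner k + slab_sides); lra.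
have := normr_ge0 (slab_corner k); lra.
Qed.

Lemma slab_lebesgue_rV_gt0 k : (0 < lebesgue_rV n.+1 (slab k))%E.
Proof.
have s0 : 0 < Num.min l 1 by rewrite lt_min l0 ltr01.
apply: (@lt_le_trans _ _ (lebesgue_rV n.+1 (cube (slab_corner k) (Num.min l 1)))).
  by rewrite lebesgue_rV_cube ?ltW// lte_fin exprn_gt0.
apply: le_measure; rewrite ?inE; [exact: cube_measurable|exact: slab_measurable|].
rewrite slabE => x xk j; have /andP[-> x2] := xk j; rewrite (le_trans x2)//=.
rewrite slab_topE lerD2l /slab_sides.
case: (ord_widen_max j) => [->|[i ->]]; first by rewrite vjoin_last ge_min lexx orbT.
by rewrite vjoin_widen mxE ge_min lexx.
Qed.

End slabs.

Section oscillating_part.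
Context {R : realType} {n : nat}.
Variables (p : R) (w : 'rV[R]_n.+1 -> R).
Hypotheses (p1 : 1 <= p) (w0 : forall x, 0 <= w x) (wL1 : locally_L1 w).

(** The function has a bump in each selected slab, so it vanishes at integer
    heights and, above an interior point of the cube, takes the same positive
    value in the middle of every selected slab. *)
Lemma oscillating_function_without_limit (a : 'rV[R]_n) (l : R)
    (m : nat -> R) (S : nat -> bool) :
  0 < l -> (forall k, weight_measure w (slab a l k) = (m k)%:E) ->
  (forall N, exists2 k, (N <= k)%N & S k) ->
  (forall N, \sum_(0 <= k < N) ((S k)%:R * m k) <= 1) ->
  exists2 u, homogeneous_sobolev p w u &
    ~ unique_ae_vertical_limit (lebesgue_representative u).
Proof.
move=> l0 wE Soo Sm.
have [theta [dtheta [C dC [dthetaE cdtheta theta0 theta_gt0 theta01]]]] := @smooth_bump R.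
have C0 : 0 <= C := le_trans (normr_ge0 _) (dC 0).
have ctheta : continuous theta := is_derive1_continuous dthetaE.
pose L (j : 'I_n.+1) : R := slab_sides l ord0 j.
have L0 j : 0 < L j by exact: slab_sides_gt0.
pose pos k (j : 'I_n.+1) (t : R) : R := (t - slab_corner a k ord0 j) / L j.
pose U k (x : 'rV[R]_n.+1) : R := (S k)%:R * \prod_j theta (pos k j (x ord0 j)).
pose D k (i j : 'I_n.+1) (t : R) : R :=
  if j == i then dtheta (pos k j t) / L j else theta (pos k j t).
pose G k (x : 'rV[R]_n.+1) : 'rV[R]_n.+1 :=
  \row_i ((S k)%:R * \prod_j D k i j (x ord0 j)).
have out k i j t : (pos k j t <= 0) || (1 <= pos k j t) ->
    theta (pos k j t) = 0 /\ D k i j t = 0.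
  by move=> /theta0[th dth]; rewrite /D dth mul0r; case: ifP.
have cpos k j : continuous (pos k j).
  apply: continuous_mul; last exact: cst_continuous.
  by move=> t; apply: cvgB; [exact: cvg_id|exact: cvg_cst].
have cD k i j : continuous (D k i j).
  rewrite /D; case: (j == i); last first.
    by move=> t; apply: continuous_comp; [exact: cpos|exact: ctheta].
  apply: continuous_mul; last exact: cst_continuous.
  by move=> t; apply: continuous_comp; [exact: cpos|exact: cdtheta].
have UG k : C1_gradient (U k) (G k).
  split.
  - apply: continuous_mul; first exact: cst_continuous.
    apply: continuous_big_prod => j x.
    apply: (@continuous_comp _ _ _ (fun x : 'rV[R]_n.+1 => x ord0 j) (theta \o pos k j)).
      exact: coord_continuous.
    by apply: continuous_comp; [exact: cpos|exact: ctheta].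
  - move=> i; under eq_fun do rewrite mxE.
    apply: continuous_mul; first exact: cst_continuous.
    apply: continuous_big_prod => j x.
    apply: (@continuous_comp _ _ _ (fun x : 'rV[R]_n.+1 => x ord0 j) (D k i j)).
      exact: coord_continuous.
    exact: cD.
  - move=> i x s; rewrite mxE.
    pose K := \prod_(j | j != i) theta (pos k j (x ord0 j)).
    have line (r : R) j : j != i -> (x + r *: delta_mx ord0 i) ord0 j = x ord0 j.
      by move=> /negbTE ji; rewrite !mxE ji andbF mulr0 addr0.
    have line_i (r : R) : (x + r *: delta_mx ord0 i) ord0 i = x ord0 i + r.
      by rewrite !mxE !eqxx mulr1.
    have -> : (fun r : R => U k (x + r *: delta_mx ord0 i)) =
        (fun r => (S k)%:R * (theta (pos k i (x ord0 i + r)) * K)).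
      apply/funext => r; rewrite /U (bigD1 i)//= line_i; congr (_ * (_ * _)).
      by apply: eq_bigr => j ji; rewrite line.
    have -> : \prod_j D k i j ((x + s *: delta_mx ord0 i) ord0 j) =
        dtheta (pos k i (x ord0 i + s)) / L i * K.
      rewrite (bigD1 i)//= line_i /D eqxx; congr (_ * _).
      by apply: eq_bigr => j ji; rewrite line// (negbTE ji).
    have dpos : is_derive s 1 (fun r : R => pos k i (x ord0 i + r)) (L i)^-1.
      by rewrite /pos; apply: is_derive_eq; rewrite /GRing.scale/=; ring.
    have dcomp := @is_derive1_comp _ theta (fun r : R => pos k i (x ord0 i + r)) s _ _
      (dthetaE _) dpos.
    by apply: is_derive_eq; rewrite /GRing.scale/=; ring.
have GE k x : G k x != 0 -> S k /\
    forall j, 0 < pos k j (x ord0 j) < 1.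
  move=> Gx.
  have [i Gi] : exists i, G k x ord0 i != 0.
    apply: contrapT => H; move/eqP: Gx; apply; apply/rowP => i; rewrite [RHS]mxE.
    by apply: contrapT => /eqP Gi; apply: H; exists i.
  move: Gi; rewrite mxE mulf_eq0 negb_or => /andP[Sk /prodf_neq0 Dj].
  split; first by move: Sk; case: (S k); rewrite ?eqxx.
  move=> j; have /eqP Dj0 := Dj j isT.
  by apply: contrapT => /negP; rewrite negb_and -!leNgt => /(out k i)[_ /Dj0].
have pos_max k (x : 'rV[R]_n.+1) : pos k ord_max (x ord0 ord_max) = x ord0 ord_max - k%:R.
  by rewrite /pos /L /slab_sides /slab_corner !vjoin_last divr1.
have below k (x : 'rV[R]_n.+1) : enorm x < k%:R -> pos k ord_max (x ord0 ord_max) <= 0.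
  move=> xk; rewrite pos_max subr_le0 (le_trans (ler_norm _))//.
  exact: le_trans (coord_le_enorm _ _) (ltW xk).
have U0 : locally_finite U.
  move=> k x /below xk; rewrite /U (bigD1 ord_max)//=.
  by have [-> _] := out k ord0 _ _ (introT orP (or_introl xk)); rewrite mul0r mulr0.
have G0 : locally_finite G.
  move=> k x /below xk; apply: contrapT => /eqP /GE[_ /(_ ord_max)].
  by rewrite ltNge xk.
have Gdisj x j k : G j x != 0 -> G k x != 0 -> j = k.
  have H i i' : (i < i')%N -> x ord0 ord_max - i%:R < 1 ->
      0 < x ord0 ord_max - i'%:R -> False.
    move=> ii'; have : i.+1%:R <= i'%:R :> R by rewrite ler_nat.
    by rewrite -natr1; lra.
  move=> /GE[_ /(_ ord_max)/andP[j1 j2]] /GE[_ /(_ ord_max)/andP[k1 k2]].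
  rewrite !pos_max in j1 j2 k1 k2.
  by case: (ltngtP j k) => // jk; exfalso; [exact: (H _ _ jk)|exact: (H _ _ jk)].
have LV j : (L j)^-1 <= 1 + l^-1.
  rewrite /L /slab_sides; case: (ord_widen_max j) => [->|[i ->]].
    by rewrite vjoin_last invr1 lerDl invr_ge0 ltW.
  by rewrite vjoin_widen mxE lerDr.
pose A := C * (1 + l^-1).
have A0 : 0 <= A by rewrite mulr_ge0// addr_ge0// invr_ge0 ltW.
pose c k : R := (S k)%:R * A.
have Gc k x i : `|G k x ord0 i| <= c k.
  rewrite mxE normrM normr_nat ler_wpM2l// normr_prod (bigD1 i)//=.
  rewrite -[leRHS]mulr1 ler_pM ?prodr_ge0//.
    rewrite /D eqxx normrM ler_pM// ger0_norm ?invr_ge0 ?(ltW (L0 _))//.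
  apply: (@le_trans _ _ (\prod_(j | j != i) (1 : R))); last by rewrite big1.
  apply: ler_prod => j /negbTE ji; rewrite normr_ge0/= /D ji.
  by have /andP[? ?] := theta01 (pos k j (x ord0 j)); rewrite ger0_norm.
exists (locally_finite_sum U).
  apply: (@sobolev_locally_finite_sum _ _ p w p1 w0 wL1 U G (slab a l) c m (A `^ p)) => //.
  - by move=> k; exact: slab_measurable.
  - move=> k x /GE[_ xk]; rewrite slabE => j; have /andP[j1 j2] := xk j.
    move: j1 j2; rewrite /pos slab_topE pmulr_lgt0 ?invr_gt0//.
    rewrite ltr_pdivrMr// mul1r subr_gt0 ltrBlDl => /ltW -> /ltW ->.
    by [].
  - move=> N; apply: (@le_trans _ _ (A `^ p * \sum_(0 <= k < N) ((S k)%:R * m k))).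
      rewrite mulr_sumr; apply: ler_sum => k _; rewrite /c.
      case: (S k); first by rewrite !mul1r.
      by rewrite !mul0r powR0 ?mul0r ?mulr0// gt_eqF// (lt_le_trans ltr01).
    by rewrite -[leRHS]mulr1 ler_wpM2l ?powR_ge0.
have [cU _ _] := C1_locally_finite_sum U0 G0 UG.
(* the middle half of the cube stays away from the zeros of the bump *)
pose Q := cube (a + const_mx (l / 4)) (l / 2).
have Q0 : (0 < lebesgue_rV n Q)%E.
  by rewrite lebesgue_rV_cube ?lte_fin ?exprn_gt0 ?divr_gt0 ?divr_ge0 ?(ltW l0).
move=> /(vertical_limit_at cU (cube_measurable _ _) Q0) [x [lim [Qx xlim]]].
pose z (t : R) : 'rV[R]_n.+1 := vjoin n.+1 x t.
have U_out j t : (t - j%:R <= 0) || (1 <= t - j%:R) -> U j (z t) = 0.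
  move=> H; rewrite /U (bigD1 ord_max)//= /z vjoin_last.
  have [|-> _] := out j ord0 ord_max t; last by rewrite mul0r mulr0.
  by have := pos_max j (z t); rewrite /z vjoin_last => ->.
have nat_out (j k : nat) : j != k ->
    (k%:R + 2^-1 - j%:R <= 0 :> R) || (1 <= k%:R + 2^-1 - j%:R :> R).
  rewrite neq_ltn => /orP[jk|kj]; apply/orP.
    right; have : j.+1%:R <= k%:R :> R by rewrite ler_nat.
    by rewrite -natr1; lra.
  left; have : k.+1%:R <= j%:R :> R by rewrite ler_nat.
  by rewrite -natr1; lra.
(* the values at heights k and k + 1 / 2 are incompatible with a limit *)
have level k : locally_finite_sum U (z k%:R) = 0.
  rewrite /locally_finite_sum big1_seq// => j _; apply: U_out.
  have [jk|kj] := leqP k j; first by rewrite subr_le0 ler_nat jk.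
  have : j.+1%:R <= k%:R :> R by rewrite ler_nat.
  by rewrite -natr1 => H; apply/orP; right; lra.
pose h := \prod_(j < n.+1) theta (if j == ord_max then 2^-1 else pos 0%N j (z 0 ord0 j)).
have h0 : 0 < h.
  apply: prodr_gt0 => j _; apply: theta_gt0.
  case: eqP => [_|/eqP jmax]; first by apply/andP; split; lra.
  case: (ord_widen_max j) jmax => [->|[i ->] _]; first by rewrite eqxx.
  rewrite /pos /z /slab_corner /L /slab_sides !vjoin_widen mxE.
  have := Qx i; rewrite !mxE => /andP[? ?].
  by rewrite ltr_pdivrMr// divr_gt0 ?subr_gt0//=; lra.
have half k : S k -> locally_finite_sum U (z (k%:R + 2^-1)) = h.
  move=> Sk; pose N := maxn k.+1 (Num.truncn (enorm (z (k%:R + 2^-1)))).+1.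
  rewrite (locally_finite_sumE (N := N) U0); last first.
    by rewrite (lt_le_trans (truncnS_gt _))// ler_nat leq_maxr.
  rewrite (bigD1_seq k) ?iota_uniq ?mem_index_iota ?leq_maxl//=.
  rewrite big1 ?addr0; last by move=> j jk; apply: U_out; exact: nat_out.
  rewrite /U Sk mul1r; apply: eq_bigr => j _; congr theta.
  case: eqP => [->|/eqP jmax].
    by rewrite pos_max /z vjoin_last addrAC subrr add0r.
  case: (ord_widen_max j) jmax => [->|[i ->] _]; first by rewrite eqxx.
  by rewrite /pos /z /slab_corner !vjoin_widen.
have [T HT] := xlim (h / 2) (divr_gt0 h0 (ltr0n _ 2)).
have [k Tk Sk] := Soo (Num.truncn `|T|).+1.
have kT : T < k%:R.
  by rewrite (le_lt_trans (ler_norm _))// (lt_le_trans (truncnS_gt _))// ler_nat.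
have := HT _ kT; rewrite -/(z _) level.
have kT2 : T < k%:R + 2^-1 by lra.
have := HT _ kT2; rewrite -/(z _) half//.
by rewrite !ltr_norml => /andP[? ?] /andP[? ?]; lra.
Qed.

End oscillating_part.

(** * Divergence of R_p and conclusion *)

Section weights_of_annuli.
Context {R : realType}.

Lemma partial_sums_unbounded (lam : nat -> R) : (forall k, 0 <= lam k) ->
  ~ (\sum_(0 <= k <oo) (lam k)%:E < +oo)%E ->
  forall M, exists N, M <= \sum_(0 <= k < N) lam k.
Proof.
move=> lam0 lamoo M; apply: contrapT => /forallNP H; apply: lamoo.
apply: (@le_lt_trans _ _ M%:E); last exact: ltry.
apply: lime_le.
  by apply: is_cvg_nneseries => k _ _; rewrite lee_fin.
apply: nearW => N; rewrite sumEFin lee_fin leNgt; apply/negP => /ltW.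
exact: H.
Qed.

Lemma infinite_subset_unbounded (S : nat -> bool) :
  (forall N, exists2 k, (N <= k)%N & S k) ->
  forall M : R, exists N, M <= \sum_(0 <= k < N) (S k)%:R.
Proof.
move=> Soo M.
have H j : exists N, j%:R <= \sum_(0 <= k < N) (S k)%:R :> R.
  elim: j => [|j [N jN]]; first by exists 0%N; rewrite big_geq.
  have [k Nk Sk] := Soo N; exists k.+1.
  rewrite big_nat_recr//= Sk -natr1 lerD2r (le_trans jN)//.
  rewrite [leRHS](big_cat_nat (n := N))//= lerDl.
  exact: sumr_ge0.
have [N MN] := H (Num.truncn `|M|).+1; exists N; apply: le_trans MN.
by rewrite (le_trans (ler_norm _))// ltW// truncnS_gt.
Qed.

(** For p = 1 take unit increments on the sparse annuli for which w(A_k) / 2^k is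
    small.  For p > 1 the terms lam_k of R_p satisfy
    lam_k ^ (1 - p) = w(A_k) / 2^(k p), so the energy of increments b_k is the sum
    of b_k ^ p lam_k ^ (1 - p), as in [divergent_series_refinement]. *)
Lemma divergent_increments (p : R) (m : nat -> R) (W : nat -> \bar R) :
  1 <= p -> (forall k, 0 < m k) -> (forall k, W k = (m k)%:E) ->
  ~ ((if p == 1%R then
        ereal_sup [set (2 ^+ k)%:E * W k `^ (-1) | k in [set: nat]]
      else \sum_(0 <= k <oo) (((2 ^+ k) `^ (p / (p - 1)))%:E *
                              W k `^ (1 - p)^-1)) < +oo)%E ->
  exists b : nat -> R, [/\ forall k, 0 <= b k,
    forall M, exists N, M <= \sum_(0 <= k < N) b k &
    exists B, forall N, \sum_(0 <= k < N) ((b k / 2 ^+ k) `^ p * m k) <= B].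
Proof.
move=> p1 m0 WE.
have pow2_gt0 k : 0 < (2 : R) ^+ k by rewrite exprn_gt0.
have [->|pN1] := eqVneq p 1 => Roo.
  have [] := @summable_subsequence R (fun k => m k / 2 ^+ k).
  - by move=> k; rewrite divr_gt0.
  - move=> e e0; apply: contrapT => /forallNP H; apply: Roo.
    apply: (@le_lt_trans _ _ (e^-1)%:E); last exact: ltry.
    apply: ge_ereal_sup => _ [k _ <-].
    rewrite WE poweR_EFin -EFinM lee_fin powR_inv1 ?(ltW (m0 k))//.
    rewrite ler_pdivrMr// ler_pdivlMl// -ler_pdivlMr//.
    by rewrite leNgt; apply/negP; exact: H.
  move=> S [Soo Sm]; exists (fun k => (S k)%:R); split => //.
    exact: infinite_subset_unbounded.
  exists 1 => N; apply: le_trans (Sm N); rewrite le_eqVlt; apply/orP; left.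
  apply/eqP/eq_bigr => k _; rewrite powRr1 ?divr_ge0 ?(ltW (pow2_gt0 _))//.
  by rewrite mulrAC mulrA.
have p1' : 1 < p by rewrite lt_neqAle eq_sym pN1.
pose lam k := (2 ^+ k) `^ (p / (p - 1)) * m k `^ (1 - p)^-1.
have lam0 k : 0 < lam k by rewrite mulr_gt0// powR_gt0.
have lamoo M : exists N, M <= \sum_(0 <= k < N) lam k.
  apply: partial_sums_unbounded => [k|]; first exact: ltW.
  apply: contra_not Roo; congr (_ < _)%E; congr (limn _).
  by apply/funext => N; apply: eq_bigr => k _; rewrite WE poweR_EFin -EFinM.
have [b [b0 boo [B bB]]] := divergent_series_refinement p1' lam0 lamoo.
exists b; split => //; exists B => N; apply: le_trans (bB N).
rewrite le_eqVlt; apply/orP; left; apply/eqP/eq_bigr => k _.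
have p1N : 1 - p != 0 by rewrite subr_eq0 eq_sym.
have -> : lam k `^ (1 - p) = (2 ^+ k) `^ (- p) * m k.
  rewrite /lam powRM ?powR_ge0// -!powRrM mulVf// powRr1 ?(ltW (m0 k))//.
  by congr (_ `^ _ * _); field; rewrite subr_eq0.
have bE : b k `^ p = (b k / 2 ^+ k) `^ p * (2 ^+ k) `^ p.
  rewrite -powRM ?(ltW (pow2_gt0 _)) ?divr_ge0 ?(ltW (pow2_gt0 _))//.
  by rewrite divfK// gt_eqF.
by rewrite bE powRN mulrA -[_ * _ * _^-1]mulrA divff ?mulr1// gt_eqF// powR_gt0.
Qed.

End weights_of_annuli.

Theorem theorem1p9 (R : realType) (d : nat) (p : R) (w : 'rV[R]_d -> R)
    (hd : (2 <= d)%N) (hp : 1 <= p < d%:R) (hw : muckenhoupt p w)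
    (hlim : forall u : 'rV[R]_d -> R, homogeneous_sobolev p w u ->
       unique_ae_vertical_limit (lebesgue_representative u)) :
  (muckenhoupt_R p w < +oo)%E /\
  forall (a : 'rV[R]_d.-1) (l : R), 0 < l ->
    (0 < ereal_inf
      [set weight_measure w
             [set vjoin d x t | x in cube a l & t in `[z%:R, (z.+1)%:R]%classic]
      | z in [set: nat]])%E.
Proof.
case: d w hd hp hw hlim => // n w _ /andP[p1 _] [w0 wL1 wpos _] hlim.
split.
  apply: contrapT => Roo.
  have /choice[m mE] k : exists m : R, 0 < m /\ weight_measure w (annulus k) = m%:E.
    have [//|m m0 mE] := weight_measure_finpos w0 wL1 wpos (annulus_measurable k)
      (@annulus_bounded _ _ k) (annulus_lebesgue_rV_gt0 k _).
    by exists m.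
  have [b [b0 boo [B bB]]] := divergent_increments p1 (fun k => (mE k).1)
    (fun k => (mE k).2) Roo.
  have [u /hlim hu] := radial_function_without_limit p1 w0 wL1
    (fun k => (mE k).2) b0 boo bB.
  exact.
move=> a l l0; rewrite ltNge; apply/negP => inf0.
have /choice[m mE] k : exists m : R, 0 < m /\ weight_measure w (slab a l k) = m%:E.
  have [M sM] := @slab_bounded _ _ a l k.
  have [m m0 mE] := weight_measure_finpos w0 wL1 wpos (slab_measurable a l k) sM
    (slab_lebesgue_rV_gt0 a l0 k).
  by exists m.
have [] := @summable_subsequence R m.
- by move=> k; exact: (mE k).1.
- move=> e e0.
  have /ereal_inf_lt[_ [k _ <-]] := le_lt_trans inf0 (e0 : (0 < e%:E)%E).
  rewrite -/(slab a l k) (mE k).2 lte_fin => mke.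
  by exists k.
move=> S [Soo Sm].
have [u /hlim hu] := oscillating_function_without_limit p1 w0 wL1 l0
  (fun k => (mE k).2) Soo Sm.
exact.
Qed.
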